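(* Let $\hat f^\lambda_n=s_\lambda(A^*A)A^*_{\mathbf x}\mathbf y$ and let the model satisfy, for $\nu$-almost every $x$, $\mathbb E(Y|X=x)=Af^\dagger(x)=y(x)$ and $Var(Y|X=x)=\sigma^2$ with $\sigma$ constant. Let $B:=A^*A$ and suppose that $f^\dagger\in\omega(r,R):=\{f\in\mathcal H_1: f=B^rw,\ \|w\|_{\mathcal H_1}\le R\}$ with $r>0$, $R>0$, and that the eigenvalues $\mu_j$ of $B$ satisfy $\mu_j\le d/j^b$ for all $j\ge1$, with $d>0$ and $b>1$. Then $$\mathbb E\left(\|\hat f^\lambda_n-f^\dagger\|^2\right)\in O\left(\left(\frac1n\right)^{\frac{2r}{2r+1+\frac1b}}\right)$$ with $\lambda\in\Theta\left(\left(\frac1n\right)^{\frac{1}{2r+1+\frac1b}}\right)$.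
   Context: Setting. $\mathcal H_1=L^2(\mathcal T,\mu)$, $\mathcal H_2=L^2(\mathcal X,\nu)$; $A:\mathcal H_1\to\mathcal H_2$ is a bounded linear operator of the form $(Af)(x)=\langle f,\phi_x\rangle_{\mathcal H_1}$ with $\phi_x\in\mathcal H_1$, $\phi_x(t)=\phi(x,t)$ and $\sup_{t\in\mathcal T}\|\phi(\cdot,t)\|_{\mathcal H_2}<\infty$; there is $c>0$ with $|(Af)(x)|\le c\|f\|_{\mathcal H_1}$ for all $x,f$. $A^*$ is the adjoint of $A$. $f^\dagger\in\mathcal H_1$ is the generalized (minimum-norm least-squares) solution of $y=Af$. The observations $(X_i,Y_i)$, $i=1,\dots,n$, are i.i.d. from a probability distribution $\rho$ on a Borel space $\mathcal X\times\mathcal Y$, $\mathcal Y\subseteq\mathbb R$, with marginal $\nu$ on $\mathcal X$; $\mathbf x=(X_1,\dots,X_n)$, $\mathbf y=(Y_1,\dots,Y_n)$, and $A^*_{\mathbf x}\mathbf y=\frac1n\sum_{j=1}^nY_j\phi_{X_j}$. $\mathbb E$ is the expectation with respect to $\rho^{\otimes n}$. Regularization functions. $s_\lambda$, $\lambda>0$, are functions on the spectrum $\sigma(A^*A)$ such that: (i) there is $D>0$ with $\sup_{t\in\sigma(A^*A)}|ts_\lambda(t)|\le D$ uniformly in $\lambda>0$; (ii) there is $E>0$ with $\sup_{\lambda>0}\sup_{t\in\sigma(A^*A)}|\lambda s_\lambda(t)|\le E$; (iii) there are $q>0$ (the qualification) and constants $C_s>0$ with $\sup_{t\in\sigma(A^*A)}|t^s(1-ts_\lambda(t))|\le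 C_s\lambda^s$ for all $\lambda>0$ and $0\le s\le q$. It is assumed that $r\le q$.
   Formalization: The measure μ is assumed σ-finite and φ jointly measurable on X×T; without this the claim fails, e.g. for counting measure μ on [0,1], ν Lebesgue and φ_x the indicator of {x}, where A = 0 but the variance is of order λ^{-2}/n. *)

(* Defs.v *)
From HB Require Import structures.
From mathcomp Require Import all_boot all_order all_algebra.
From mathcomp Require Import all_classical all_reals all_analysis.
Set Implicit Arguments.
Unset Strict Implicit.
Unset Printing Implicit Defensive.
Import Order.TTheory GRing.Theory Num.Theory.
Import numFieldNormedType.Exports.
Local Open Scope classical_set_scope.
Local Open Scope ring_scope.

(* Real L^2 spaces.  LfunType is the vector space of square-integrable
   functions; the Hilbert space is its quotient by almost-everywhere equality,
   so equality of vectors is always written _ = _ %[ae mu] below. *)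

Notation L2 mu := (LfunType mu (lee1n 2)).

Section L2.
Context (d : measure_display) (T : measurableType d) (R : realType).
Variable mu : {measure set T -> \bar R}.

Definition L2norm (f : L2 mu) : R := fine 'N[mu]_2%:R%:E[EFin \o f]%E.

Definition L2dot (f g : L2 mu) : R := (\int[mu]_t (f t * g t))%R.

End L2.

Section operators.
Context (d1 d2 : measure_display) (T : measurableType d1)
  (X : measurableType d2) (R : realType).
Variables (mu : {measure set T -> \bar R}) (nu : {measure set X -> \bar R}).

Definition L2bounded (A : L2 mu -> L2 nu) : Prop :=
  exists M : R, forall f : L2 mu, L2norm (A f) <= M * L2norm f.

(* Joint measurability of phi is what gives a meaning to the measure theory
   around the kernel (Fubini, random elements of L^2(T, mu)). *)
Record kernel_operator (phi : X -> L2 mu) (A : {linear L2 mu -> L2 nu}) :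
    Prop := KernelOperator {
  kernel_measurable : measurable_fun [set: X * T] (fun z => phi z.1 z.2) ;
  kernel_sections : exists M : R, forall t : T,
    phi^~ t \in Lfun nu 2%:R%:E /\
    ('N[nu]_2%:R%:E[EFin \o phi^~ t] <= M%:E)%E ;
  operator_bounded : L2bounded A ;
  operator_kernel : forall (f : L2 mu) (x : X), A f x = L2dot f (phi x) ;
  operator_pointwise : exists2 c : R, 0 < c &
    forall (f : L2 mu) (x : X), `|A f x| <= c * L2norm f }.

Definition is_adjoint (A : L2 mu -> L2 nu) (A' : L2 nu -> L2 mu) : Prop :=
  forall (f : L2 mu) (g : L2 nu), L2dot (A f) g = L2dot f (A' g).

Definition least_squares_solution (A : L2 mu -> L2 nu) (y : L2 nu)
    (f : L2 mu) : Prop :=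
  forall g : L2 mu, L2norm (A f - y) <= L2norm (A g - y).

Definition generalized_solution (A : L2 mu -> L2 nu) (y : L2 nu)
    (f : L2 mu) : Prop :=
  least_squares_solution A y f /\
  forall g : L2 mu, least_squares_solution A y g -> L2norm f <= L2norm g.

End operators.

Section spectral.
Context (d : measure_display) (T : measurableType d) (R : realType).
Variable mu : {measure set T -> \bar R}.

(* For self-adjoint B the real spectrum is the whole spectrum. *)
Definition spectrum (B : L2 mu -> L2 mu) : set R :=
  [set t | ~ exists2 S : L2 mu -> L2 mu, L2bounded S &
     forall f : L2 mu,
       S (B f - t *: f) = f %[ae mu] /\ B (S f) - t *: S f = f %[ae mu]].

(* Spectral decomposition of a compact positive self-adjoint operator: the
   positive mu_ j are the nonzero eigenvalues, repeated according to
   multiplicity, in no prescribed order.  If there are finitely many of them,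
   mu_ is padded with zeros; e j is irrelevant when mu_ j = 0. *)
Record eigensystem (B : L2 mu -> L2 mu) (mu_ : nat -> R) (e : nat -> L2 mu) :
    Prop := Eigensystem {
  eigenvalue_ge0 : forall j, 0 <= mu_ j ;
  eigenvectorE : forall j, 0 < mu_ j -> B (e j) = mu_ j *: e j %[ae mu] ;
  eigenvector_ortho : forall i j, 0 < mu_ i -> 0 < mu_ j ->
    L2dot (e i) (e j) = (i == j)%:R ;
  eigenvector_complete : forall f : L2 mu,
    (forall j, 0 < mu_ j -> L2dot f (e j) = 0) -> B f = 0 %[ae mu] }.

(* N-th partial sum of
     h(B) f = sum_(j : mu_ j > 0) h(mu_ j) <f, e_j> e_j + h(0) P f,
   where P f = f - sum_(j : mu_ j > 0) <f, e_j> e_j is the orthogonal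
   projection of f onto the kernel of B. *)
Definition spectral_sum (mu_ : nat -> R) (e : nat -> L2 mu) (h : R -> R)
    (f : L2 mu) (N : nat) : L2 mu :=
  \sum_(j < N | 0 < mu_ j) (h (mu_ j) * L2dot f (e j)) *: e j
  + h 0 *: (f - \sum_(j < N | 0 < mu_ j) L2dot f (e j) *: e j).

(* h(B) f, the limit in L^2(T, mu) of the partial sums (which exists for h
   bounded on the spectrum of B). *)
Definition spectral_fun (mu_ : nat -> R) (e : nat -> L2 mu) (h : R -> R)
    (f : L2 mu) : L2 mu :=
  xget 0 [set g : L2 mu |
    (fun N => L2norm (spectral_sum mu_ e h f N - g)) @ \oo --> (0 : R)].

(* omega(r, R) = { B^r w | ||w|| <= rad } *)
Definition source_set (mu_ : nat -> R) (e : nat -> L2 mu) (r rad : R) :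
    set (L2 mu) :=
  [set f | exists2 w : L2 mu, L2norm w <= rad &
     f = spectral_fun mu_ e (fun t => t `^ r) w %[ae mu]].

End spectral.

(* s lam t is s_lambda(t); only its values for lam > 0 and t in the spectrum
   spec matter. *)
Record regularization (R : realType) (spec : set R) (s : R -> R -> R) (q : R) :
    Prop := Regularization {
  regularization_ts : exists2 D : R, 0 < D &
    forall lam t, 0 < lam -> spec t -> `|t * s lam t| <= D ;
  regularization_lams : exists2 E : R, 0 < E &
    forall lam t, 0 < lam -> spec t -> `|lam * s lam t| <= E ;
  qualification_gt0 : 0 < q ;
  qualification : exists2 C : R -> R, (forall a, 0 <= a <= q -> 0 < C a) &
    forall a lam t, 0 <= a <= q -> 0 < lam -> spec t ->
      `|t `^ a * (1 - t * s lam t)| <= C a * lam `^ a }.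

Section sampling.
Context (d : measure_display) (X : measurableType d) (R : realType).

(* g is a version of x |-> E(Z | X = x), where (X, Y) has law rho, nu is the
   law of X and Z is a function of (X, Y). *)
Definition conditional_expectation (rho : probability (X * R)%type R)
    (nu : probability X R) (Z : X * R -> R) (g : X -> R) : Prop :=
  [/\ rho.-integrable setT (EFin \o Z),
      measurable_fun setT g &
      forall U : set X, measurable U ->
        (\int[rho]_(z in U `*` setT) (Z z)%:E = \int[nu]_(x in U) (g x)%:E)%E].

(* v is a version of x |-> Var(Z | X = x). *)
Definition conditional_variance (rho : probability (X * R)%type R)
    (nu : probability X R) (Z : X * R -> R) (v : X -> R) : Prop :=
  exists2 m : X -> R, conditional_expectation rho nu Z m &
    conditional_expectation rho nu (fun z => (Z z - m z.1) ^+ 2) v.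

End sampling.

Section product.
Context (d : measure_display) (T : measurableType d) (R : realType).

Definition cons_tuple (n : nat) (z : T * n.-tuple T) : n.+1.-tuple T :=
  [the n.+1.-tuple T of z.1 :: z.2].

Lemma measurable_cons_tuple (n : nat) :
  measurable_fun [set: T * n.-tuple T] (@cons_tuple n).
Proof. exact: measurable_cons. Qed.

HB.instance Definition _ (n : nat) :=
  isMeasurableFun.Build _ _ _ _ (@cons_tuple n) (@measurable_cons_tuple n).

Fixpoint product_power (rho : probability T R) (n : nat) :
    probability (n.-tuple T) R :=
  match n with
  | 0 => dirac [tuple]
  | m.+1 => distribution (rho \x product_power rho m)%E (@cons_tuple m)
  end.

End product.

Section estimator.
Context (d1 d2 : measure_display) (T : measurableType d1)
  (X : measurableType d2) (R : realType).
Variable mu : {measure set T -> \bar R}.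

(* A_x^* y = 1/n sum_j Y_j phi_(X_j) for the sample z = (X_j, Y_j)_j *)
Definition empirical_adjoint (phi : X -> L2 mu) (n : nat)
    (z : n.-tuple (X * R)) : L2 mu :=
  n%:R^-1 *: \sum_(j < n) (tnth z j).2 *: phi (tnth z j).1.

Definition estimator (phi : X -> L2 mu) (mu_ : nat -> R) (e : nat -> L2 mu)
    (s : R -> R -> R) (lam : R) (n : nat) (z : n.-tuple (X * R)) : L2 mu :=
  spectral_fun mu_ e (s lam) (empirical_adjoint phi z).

End estimator.

Section risk.
Context (d1 d2 : measure_display) (T : measurableType d1)
  (X : measurableType d2) (R : realType).
Variable mu : {measure set T -> \bar R}.

Definition risk (rho : probability (X * R)%type R) (fdag : L2 mu) (n : nat)
    (fhat : n.-tuple (X * R) -> L2 mu) : \bar R :=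
  ('E_(product_power rho n)[fun z => (L2norm (fhat z - fdag) ^+ 2)%R])%E.

End risk.

(* Main.v *)
Require Import Defs.
From mathcomp Require Import all_boot all_order all_algebra.
From mathcomp Require Import all_classical all_reals all_analysis.
From mathcomp Require Import measurable_realfun ring lra.
Import Order.TTheory GRing.Theory Num.Theory.
Import numFieldNormedType.Exports.
Set Implicit Arguments.
Unset Strict Implicit.
Unset Printing Implicit Defensive.
Local Open Scope classical_set_scope.
Local Open Scope ring_scope.

(** The estimator is diagonal in the eigenvectors e_j of B = A^* A.  If a_j is the
    coefficient of the empirical adjoint along e_j and f_j that of fdag, then
    s_lambda(B) multiplies a_j by s_j = s_lambda(mu_j), so that, by Parseval,
      ||fhat - fdag||^2 = sum_j (s_j a_j - f_j)^2,
    where a_j is the empirical mean of Y (A e_j)(X).  Its expectation is the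
    inner product of A fdag and A e_j, that is mu_j f_j, and since ||A e_j||^2 =
    mu_j its variance is at most V mu_j / n (noise_moments).  Hence the risk is
    at most
      sum_j (1 - s_j mu_j)^2 f_j^2 + (V / n) sum_j s_j^2 mu_j.
    With f_j = mu_j^r w_j the qualification bounds the bias by a multiple of
    lambda^(2r).  For the variance, s_j^2 mu_j is at most a multiple of both
    1 / lambda and mu_j / lambda^2; with mu_j <= d / j^b the sum is of order
    lambda^(-1-1/b), by cutting it at j about lambda^(-1/b)
    (effective_dimension_sum).  Both contributions (risk_le) are of order
    n^(-2r/(2r+1+1/b)) when lambda is of order n^(-1/(2r+1+1/b)).

    Three analytic facts support this computation.  Spectral functions are limits
    of orthogonal series, whose existence rests on the completeness of L^2
    (L2_complete, spectral_fun_cvg).  Parseval's identity has no term for the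
    kernel of B because the kernel sections phi x, hence almost surely the
    empirical adjoint, lie in the closed span of the e_j for almost every x.
    This is kernel_expansion; it needs a null set of x that does not depend on a
    vector of the kernel, although L^2(mu) may fail to be separable, and it is
    obtained by expanding phi in L^2 of the product measure.  Finally the squared
    error is only compared with a measurable function of the sample, which
    suffices because the integral of nonnegative functions is monotone
    (ge0_le_integral_nonmeasurable). *)

(** * The inner product of L^2 *)

Section L2_inner_product.
Context (d : measure_display) (T : measurableType d) (R : realType).
Variable mu : {measure set T -> \bar R}.
Implicit Types (f g h : L2 mu) (a : R).

Lemma L2DE f g t : (f + g) t = f t + g t. Proof. by []. Qed.
Lemma L2ZE a f t : (a *: f) t = a * f t. Proof. by []. Qed.
Lemma L2_sumE I (r : seq I) (P : pred I) (F : I -> L2 mu) t :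
  (\sum_(i <- r | P i) F i) t = \sum_(i <- r | P i) F i t.
Proof. by elim/big_rec2: _ => // i x y _ <-. Qed.

Lemma L2_mulr_integrable f g :
  mu.-integrable setT (fun t => (f t * g t)%:E).
Proof. by apply/Lfun1_integrable/Lfun2_mul_Lfun1; exact: LfunP. Qed.

Lemma L2_sqr_integrable f : mu.-integrable setT (fun t => (f t ^+ 2)%:E).
Proof. by apply: Lfun2_integrable_sqr; exact: LfunP. Qed.

Lemma L2dotE f g : (L2dot f g)%:E = (\int[mu]_t (f t * g t)%:E)%E.
Proof.
by rewrite /L2dot /Rintegral fineK// integrable_fin_num//; exact: L2_mulr_integrable.
Qed.

Lemma L2dotC f g : L2dot f g = L2dot g f.
Proof. by apply: eq_Rintegral => t _; rewrite mulrC. Qed.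

Lemma L2dotDl f g h : L2dot (f + g) h = L2dot f h + L2dot g h.
Proof.
rewrite /L2dot -RintegralD//; try exact: L2_mulr_integrable.
by apply: eq_Rintegral => t _; rewrite L2DE mulrDl.
Qed.

Lemma L2dotZl a f h : L2dot (a *: f) h = a * L2dot f h.
Proof.
rewrite /L2dot -RintegralZl//; try exact: L2_mulr_integrable.
by apply: eq_Rintegral => t _; rewrite L2ZE mulrA.
Qed.

Lemma L2dotNl f h : L2dot (- f) h = - L2dot f h.
Proof. by rewrite -scaleN1r L2dotZl mulN1r. Qed.

Lemma L2dotBl f g h : L2dot (f - g) h = L2dot f h - L2dot g h.
Proof. by rewrite L2dotDl L2dotNl. Qed.

Lemma L2dot0l h : L2dot 0 h = 0.
Proof. by rewrite -(scale0r 0) L2dotZl mul0r. Qed.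

Lemma L2dot_suml I (r : seq I) (P : pred I) (F : I -> L2 mu) h :
  L2dot (\sum_(i <- r | P i) F i) h = \sum_(i <- r | P i) L2dot (F i) h.
Proof.
elim/big_rec2: _ => [|i x y _ <-]; first exact: L2dot0l.
by rewrite L2dotDl.
Qed.

Lemma L2dotBr f g h : L2dot f (g - h) = L2dot f g - L2dot f h.
Proof. by rewrite L2dotC L2dotBl !(L2dotC f). Qed.

Lemma L2dotZr a f h : L2dot f (a *: h) = a * L2dot f h.
Proof. by rewrite L2dotC L2dotZl !(L2dotC f). Qed.

Lemma L2dot_sumr I (r : seq I) (P : pred I) (F : I -> L2 mu) h :
  L2dot h (\sum_(i <- r | P i) F i) = \sum_(i <- r | P i) L2dot h (F i).
Proof. by rewrite L2dotC L2dot_suml; apply: eq_bigr => i _; rewrite L2dotC. Qed.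

Lemma L2norm_ge0 f : 0 <= L2norm f.
Proof. by rewrite /L2norm fine_ge0// Lnorm_ge0. Qed.

Lemma L2norm_sqr f : L2norm f ^+ 2 = L2dot f f.
Proof.
apply: EFin_inj; rewrite L2dotE -powR_mulrn ?L2norm_ge0//.
rewrite -poweR_EFin finite_norm_fine powR_Lnorm//.
by apply: eq_integral => t _; rewrite /= powR_mulrn// real_normK// ?num_real// expr2.
Qed.

Lemma L2norm_sqrE f : (L2norm f ^+ 2)%:E = (\int[mu]_t (f t ^+ 2)%:E)%E.
Proof. by rewrite L2norm_sqr L2dotE. Qed.

Lemma ler_L2normD f g : L2norm (f + g) <= L2norm f + L2norm g.
Proof. exact: ler_LnormD. Qed.

Lemma L2normZ a f : L2norm (a *: f) = `|a| * L2norm f.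
Proof.
apply: (@pexpIrn _ 2) => //; rewrite ?nnegrE ?mulr_ge0 ?L2norm_ge0//.
by rewrite exprMn !L2norm_sqr L2dotZl L2dotZr mulrA real_normK ?num_real.
Qed.

Lemma L2normN f : L2norm (- f) = L2norm f.
Proof. by rewrite -scaleN1r L2normZ normrN1 mul1r. Qed.

Lemma L2normB f g : L2norm (f - g) = L2norm (g - f).
Proof. by rewrite -opprB L2normN. Qed.

Lemma L2norm0 : L2norm (0 : L2 mu) = 0.
Proof. by rewrite -(scale0r 0) L2normZ normr0 mul0r. Qed.

Lemma ler_L2normB f g h : L2norm (f - h) <= L2norm (f - g) + L2norm (g - h).
Proof. by rewrite -(subrKA g) ler_L2normD. Qed.

(** Vectors are functions, not classes: a vector of norm 0 is only almost
    everywhere null, which makes the case L2norm g = 0 a statement about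
    integrals.  Otherwise the squared norm of the residual of f along g is the
    difference of the two sides divided by L2norm g ^+ 2. *)
Lemma L2dot_CS f g : `|L2dot f g| <= L2norm f * L2norm g.
Proof.
rewrite -ler_sqr ?nnegrE ?mulr_ge0 ?L2norm_ge0// exprMn.
have [g0|g0] := eqVneq (L2norm g) 0.
  have ae : (fun t => (f t * g t)%:E) = (cst 0%E) %[ae mu].
    apply: filterS (fine_Lnormr_eq0 g0) => t /= /(_ I) gt _.
    by rewrite gt mulr0.
  have -> : L2dot f g = 0.
    apply: EFin_inj; rewrite L2dotE.
    rewrite (ae_eq_integral (cst 0%E) _ _ _ _ ae) ?integral0//.
    by case/integrableP: (L2_mulr_integrable f g).
  by rewrite normr0 expr0n mulr_ge0// sqr_ge0.
have g2 : 0 < L2norm g ^+ 2 by rewrite exprn_gt0// lt_neqAle eq_sym g0 L2norm_ge0.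
rewrite real_normK ?num_real//.
have := sqr_ge0 (L2norm (f - (L2dot f g / L2norm g ^+ 2) *: g)).
rewrite [X in _ <= X]L2norm_sqr L2dotBl !L2dotBr !L2dotZr !L2dotZl (L2dotC g f) -!L2norm_sqr.
set x := L2dot f g; set G := L2norm g ^+ 2 in g2 *; set F := L2norm f ^+ 2.
move=> H; rewrite -ler_pdivrMr//.
have GN : G != 0 by rewrite gt_eqF.
have E : F - x / G * x - (x / G * x - x / G * (x / G * G)) = F - x ^+ 2 / G by field.
by move: H; rewrite E subr_ge0.
Qed.

Lemma L2dot_norm0 f g : L2norm f = 0 -> L2dot f g = 0.
Proof. by move=> f0; apply/eqP; rewrite -normr_le0 (le_trans (L2dot_CS _ _))// f0 mul0r. Qed.

Lemma L2norm_ae_eq0 f : f = 0 %[ae mu] -> L2norm f = 0.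
Proof.
move=> f0; apply/eqP; rewrite -sqrf_eq0; apply/eqP/EFin_inj.
rewrite L2norm_sqrE.
have ae : (fun t => (f t ^+ 2)%:E) = (cst 0%E) %[ae mu].
  by apply: filterS f0 => t /= /(_ I) -> _; rewrite expr0n.
rewrite (ae_eq_integral (cst 0%E) _ _ _ _ ae) ?integral0//.
by case/integrableP: (L2_sqr_integrable f).
Qed.

(** The gate through which almost everywhere equalities enter: from here on
    they are used as vanishing distances, to which Cauchy-Schwarz applies. *)
Lemma L2norm_ae_eq f g : f = g %[ae mu] -> L2norm (f - g) = 0.
Proof.
move=> fg; apply: L2norm_ae_eq0.
by apply: filterS fg => t /= /(_ I) fg _; rewrite -[LHS]/(f t - g t) fg subrr.
Qed.

Lemma L2norm_eq_dist f g : L2norm (f - g) = 0 -> L2norm f = L2norm g.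
Proof.
move=> fg0; apply/eqP; rewrite eq_le.
have := ler_L2normB f g 0; have := ler_L2normB g f 0.
by rewrite !subr0 (L2normB g) fg0 !add0r => -> ->.
Qed.

Lemma ler_dist_L2norm f g : `|L2norm f - L2norm g| <= L2norm (f - g).
Proof.
have := ler_L2normB f g 0; have := ler_L2normB g f 0.
rewrite !subr0 (L2normB g f) => h1 h2.
by rewrite ler_norml; apply/andP; split; lra.
Qed.

Lemma L2dot_eq_dist f g h : L2norm (f - g) = 0 -> L2dot f h = L2dot g h.
Proof. by move=> fg0; apply/eqP; rewrite -subr_eq0 -L2dotBl L2dot_norm0. Qed.

End L2_inner_product.

(** * Completeness of L^2 *)

Section L2_completeness.
Context (d : measure_display) (T : measurableType d) (R : realType).
Variable mu : {measure set T -> \bar R}.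

Lemma L2_of_fun (f : T -> R) : measurable_fun setT f ->
  (\int[mu]_t (f t ^+ 2)%:E < +oo)%E -> {g : L2 mu | g = f :> (T -> R)}.
Proof.
move=> mf f2; suff fL : f \in Lfun mu 2%:R%:E by exists (Lfun_Sub (lee1n 2) fL).
rewrite inE; apply/andP; split; first by rewrite inE.
rewrite inE/= /finite_norm unlock /Lnorm poweR_lty//.
rewrite (eq_integral (fun t => (f t ^+ 2)%:E))// => t _.
by rewrite /= powR_mulrn// real_normK// num_real.
Qed.

(** The increments are at most sqrt D * 2^-k, so the tail after k is a
    geometric sum bounded by 2 * sqrt D * 2^-k. *)
Lemma fast_cauchy_cvg (a : nat -> R) (D : R) :
  (forall k, 4 ^+ k * (a k.+1 - a k) ^+ 2 <= D) ->
  cvgn a /\ forall k, (a k - limn a) ^+ 2 <= 4 * D * 4^-1 ^+ k.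
Proof.
move=> aD; have D0 : 0 <= D.
  by apply: le_trans (aD 0%N); rewrite expr0 mul1r sqr_ge0.
set s := Num.sqrt D.
have s0 : 0 <= s by exact: sqrtr_ge0.
have step k : `|a k.+1 - a k| <= s * 2^-1 ^+ k.
  rewrite -ler_sqr ?nnegrE ?mulr_ge0 ?exprn_ge0// real_normK ?num_real//.
  rewrite exprMn sqr_sqrtr// -exprM mulnC exprM.
  have -> : (2^-1 : R) ^+ 2 = 4^-1 by rewrite exprVn; congr (_^-1); ring.
  by rewrite exprVn ler_pdivlMr ?exprn_gt0// mulrC.
have dist m k : `|a (k + m)%N - a k| <= 2 * s * (2^-1 ^+ k - 2^-1 ^+ (k + m)).
  elim: m => [|m IH]; first by rewrite addn0 !subrr normr0 mulr0.
  rewrite addnS -(subrKA (a (k + m)%N)) (le_trans (ler_normD _ _))//.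
  apply: (le_trans (lerD (step _) IH)).
  rewrite exprS; set u := _ ^+ (k + m); set v := _ ^+ k.
  by rewrite le_eqVlt; apply/orP; left; apply/eqP; field.
have dist' m k : (k <= m)%N -> `|a m - a k| <= 2 * s * 2^-1 ^+ k.
  move=> km; rewrite -(subnKC km) (le_trans (dist _ _))//.
  by rewrite ler_wpM2l ?mulr_ge0// gerBl exprn_ge0.
have ca : cvgn a.
  apply/cauchy_cvgP/cauchy_exP => e e0; near_simpl.
  have /cvgrPdist_lt/(_ e e0) : geometric (2 * s) (2^-1 : R) @ \oo --> 0.
    by apply: cvg_geometric; rewrite ger0_norm// invf_lt1// ltr1n.
  move=> [k _ /(_ k (leqnn k))]; rewrite /= sub0r normrN => ke.
  exists (a k); exists k => //= m km; rewrite /ball/= distrC.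
  apply: le_lt_trans (dist' _ _ km) _.
  by apply: le_lt_trans ke; rewrite ler_norm.
split=> // k.
have l1 : `|a k - limn a| <= 2 * s * 2^-1 ^+ k.
  rewrite distrC.
  have cv : (fun m => `|a m - a k|) @ \oo --> `|limn a - a k|.
    by apply: cvg_norm; apply: cvgB => //; exact: cvg_cst.
  rewrite -(cvg_lim _ cv)//; apply: limr_le; first by apply/cvg_ex; eexists; exact: cv.
  by exists k => // m /= km; exact: dist'.
rewrite -ler_sqr ?nnegrE ?mulr_ge0 ?exprn_ge0// real_normK ?num_real// in l1.
apply: (le_trans l1).
rewrite !exprMn sqr_sqrtr// -exprM mulnC exprM.
have -> : (2^-1 : R) ^+ 2 = 4^-1 by rewrite exprVn; congr (_^-1); ring.
by have -> : (2 : R) ^+ 2 = 4 by ring.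
Unshelve. all: by end_near. Qed.

(** The weight 4^k is small enough for D = sum_k 4^k |v_(k+1) - v_k|^2 to have
    integral at most sum_k 4^k 8^-k = 2, and large enough for v_k(t) to converge
    geometrically wherever D(t) is finite.  The pointwise bound
    |v_k - g|^2 <= 4 D 4^-k, vacuous where D is infinite, then integrates to the
    rate in norm. *)
Lemma L2_fast_cauchy_cvg (v : nat -> L2 mu) :
  (forall k, L2norm (v k.+1 - v k) ^+ 2 <= 8^-1 ^+ k) ->
  exists g : L2 mu, forall k, L2norm (v k - g) ^+ 2 <= 8 * 4^-1 ^+ k.
Proof.
move=> vk.
pose Dk k t : \bar R := (4 ^+ k * (v k.+1 t - v k t) ^+ 2)%:E.
pose D t : \bar R := (\sum_(k <oo) Dk k t)%E.
have Dk0 k t : (0 <= Dk k t)%E.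
  by rewrite lee_fin; apply: mulr_ge0; [exact: exprn_ge0|exact: sqr_ge0].
have mDk k : measurable_fun setT (Dk k : T -> \bar R).
  apply/measurable_EFinP; apply: measurable_funM => //.
  by apply: measurable_funX; exact: measurable_funB.
have mD : measurable_fun setT (D : T -> \bar R) by exact: ge0_emeasurable_sum.
have D0 t : (0 <= D t)%E by exact: nneseries_ge0.
have iD : (\int[mu]_t D t <= 2%:E)%E.
  rewrite integral_nneseries//.
  apply: le_trans (epsilon_trick0 xpredT (ler0n R 2)).
  apply: lee_nneseries => [k _ _|k _]; first exact: integral_ge0.
  rewrite /Dk; under eq_integral do rewrite EFinM.
  rewrite ge0_integralZl_EFin//; first last.
  - apply/measurable_EFinP; apply: measurable_funX; exact: measurable_funB.
  - by move=> t _; rewrite lee_fin sqr_ge0.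
  rewrite -[X in (_ * X)%E]/(\int[mu]_t ((v k.+1 - v k) t ^+ 2)%:E)%E.
  rewrite -L2norm_sqrE -EFinM lee_fin.
  apply: (le_trans (ler_wpM2l _ (vk k))); first exact: exprn_ge0.
  rewrite natrX exprS invfM mulrA divff// mul1r -exprVn -exprMn.
  by have -> : 4 * 8^-1 = 2^-1 :> R by lra.
have Dfin t : (D t < +oo)%E -> forall k, 4 ^+ k * (v k.+1 t - v k t) ^+ 2 <= fine (D t).
  move=> Dt k; rewrite -lee_fin fineK ?ge0_fin_numE//.
  apply: le_trans (nneseries_lim_ge k.+1 _); last by move=> *; exact: Dk0.
  by rewrite big_nat_recr//= leeDr// sume_ge0.
pose good := [set t | (D t < +oo)%E].
have mgood : measurable good.
  rewrite -[good]setTI; exact: emeasurable_fun_infty_o.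
pose h k := (v k : T -> R) \_ good.
pose g t := limn (h ^~ t).
have hE t : good t -> h ^~ t = v ^~ t.
  by move=> gt; apply/funext => k; rewrite /h patchE mem_set.
have gP t : good t ->
    cvgn (v^~ t) /\ forall k, (v k t - g t) ^+ 2 <= 4 * fine (D t) * 4^-1 ^+ k.
  by move=> gt; have := fast_cauchy_cvg (Dfin t gt); rewrite /g hE.
have mg : measurable_fun setT g.
  apply: (measurable_fun_cvg (h := h)) => [k|t _].
    by apply/(measurable_restrictT (v k : T -> R)) => //; apply: measurable_funTS.
  rewrite /g; have [gt|bt] := pselect (good t).
    by rewrite hE//; have [] := gP t gt.
  have -> : h ^~ t = cst 0 by apply/funext => k; rewrite /h patchE memNset.
  by rewrite lim_cst//; exact: cvg_cst.
have vg k : (\int[mu]_t ((v k t - g t) ^+ 2)%:E <= (8 * 4^-1 ^+ k)%:E)%E.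
  apply: (@le_trans _ _ (\int[mu]_t ((4 * 4^-1 ^+ k)%:E * D t))%E).
    apply: ge0_le_integral => //.
    - by move=> t _; rewrite lee_fin sqr_ge0.
    - apply/measurable_EFinP; apply: measurable_funX; exact: measurable_funB.
    - exact: measurable_funeM.
    - move=> t _; have [gt|bt] := pselect (good t).
        rewrite -(@fineK _ (D t)) ?ge0_fin_numE// -EFinM lee_fin.
        by rewrite mulrAC; exact: (gP t gt).2.
      have -> : D t = +oo%E by apply/eqP; rewrite -leye_eq leNgt; exact/negP.
      by rewrite gt0_muley ?leey// lte_fin mulr_gt0// exprn_gt0.
  rewrite ge0_integralZl_EFin//.
  apply: le_trans (lee_wpmul2l _ iD) _; first by rewrite lee_fin mulr_ge0// exprn_ge0.
  by rewrite -EFinM lee_fin mulrAC -natrM.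
(* The limit g is reached through v 0 - g, whose square has already been
   shown to be integrable. *)
have [w wE] : {w : L2 mu | w = (fun t => v 0%N t - g t) :> (T -> R)}.
  apply: L2_of_fun; first exact: measurable_funB.
  by apply: le_lt_trans (vg 0%N) _; rewrite ltry.
exists (v 0%N - w) => k; rewrite -lee_fin L2norm_sqrE.
apply: le_trans (vg k); rewrite le_eqVlt; apply/orP; left; apply/eqP.
apply: eq_integral => t _; congr ((_ ^+ 2)%:E).
rewrite -[LHS]/(v k t - (v 0%N t - w t)) wE.
by rewrite subKr.
Qed.

(** Riesz-Fischer: extract a subsequence whose increments decay like 8^-k. *)
Theorem L2_complete (u : nat -> L2 mu) :
  (forall eps, 0 < eps -> exists N, forall m n, (N <= m)%N -> (N <= n)%N ->
     L2norm (u m - u n) <= eps) ->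
  exists g : L2 mu, (fun n => L2norm (u n - g)) @ \oo --> 0.
Proof.
move=> cu.
have e8 k : 0 < Num.sqrt (8^-1 ^+ k : R) by rewrite sqrtr_gt0 exprn_gt0.
have /choice[N NP] : forall k, exists N, forall m n, (N <= m)%N -> (N <= n)%N ->
    L2norm (u m - u n) <= Num.sqrt (8^-1 ^+ k : R).
  by move=> k; exact: cu.
(* Summing the thresholds makes the extraction nondecreasing, and the
   successors make it unbounded. *)
pose M k := (\sum_(i < k.+1) (N i).+1)%N.
have MN k : (N k <= M k)%N by rewrite /M big_ord_recr/= addnS leqW// leq_addl.
have kM k : (k <= M k)%N.
  by rewrite /M; elim: k => // k IH; rewrite big_ord_recr/= addnS ltnS (leq_trans IH)// leq_addr.
have MS k : (M k <= M k.+1)%N by rewrite /M (big_ord_recr k.+1)/= leq_addr.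
have [g gP] : exists g : L2 mu, forall k, L2norm (u (M k) - g) ^+ 2 <= 8 * 4^-1 ^+ k.
  apply: (@L2_fast_cauchy_cvg (fun k => u (M k))) => k.
  rewrite -[leRHS]sqr_sqrtr ?exprn_ge0// ler_sqr ?nnegrE ?L2norm_ge0 ?sqrtr_ge0//.
  by apply: NP => //; exact: leq_trans (MN k) (MS k).
exists g; apply/cvgr0Pnorm_le => e e0.
have [K KP] := cu (e / 2) (divr_gt0 e0 (ltr0n _ 2)).
have : \forall k \near \oo, 8 * 4^-1 ^+ k <= (e / 2) ^+ 2 :> R.
  have /cvgr0Pnorm_le/(_ ((e / 2) ^+ 2)) : geometric 8 (4^-1 : R) @ \oo --> 0.
    by apply: cvg_geometric; rewrite ger0_norm// invf_lt1// ltr1n.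
  rewrite exprn_gt0 ?divr_gt0// => /(_ isT); apply: filterS => k /=.
  by apply: le_trans; rewrite ler_norm.
move=> [k0 _ k0P].
exists K => // n /= Kn; rewrite ger0_norm ?L2norm_ge0//.
pose k := maxn k0 K.
apply: le_trans (ler_L2normB _ (u (M k)) _) _; rewrite (splitr e) lerD//.
  by apply: KP => //; rewrite (leq_trans _ (kM k))// leq_maxr.
have e20 : 0 <= e / 2 by rewrite ltW// divr_gt0.
rewrite -ler_sqr ?nnegrE ?L2norm_ge0//.
by apply: (le_trans (gP k)); apply: k0P; rewrite /= leq_maxl.
Qed.

End L2_completeness.

(** * Orthonormal series *)

Section orthonormal_series.
Context (d : measure_display) (T : measurableType d) (R : realType).
Variables (mu : {measure set T -> \bar R}) (P : pred nat) (e : nat -> L2 mu).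
Hypothesis e_ortho : forall i j, P i -> P j -> L2dot (e i) (e j) = (i == j)%:R.

Lemma L2dot_orthosum (c : nat -> R) m n k : P k -> (m <= k < n)%N ->
  L2dot (\sum_(m <= j < n | P j) c j *: e j) (e k) = c k.
Proof.
move=> Pk mkn; rewrite L2dot_suml.
rewrite big_mkcond (bigD1_seq k) ?mem_index_iota ?iota_uniq//= Pk.
rewrite L2dotZl e_ortho// eqxx mulr1 big1 ?addr0// => j jk; case: ifP => // Pj.
by rewrite L2dotZl e_ortho// (negbTE jk) mulr0.
Qed.

Lemma L2norm_orthosum (c : nat -> R) m n :
  L2norm (\sum_(m <= j < n | P j) c j *: e j) ^+ 2 =
  \sum_(m <= j < n | P j) c j ^+ 2.
Proof.
rewrite L2norm_sqr {2}big_nat_cond L2dot_sumr [RHS]big_nat_cond.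
by apply: eq_bigr => k /andP[mkn Pk]; rewrite L2dotZr L2dot_orthosum// expr2.
Qed.

Lemma L2norm_orthosum_residual f n :
  L2norm (f - \sum_(0 <= j < n | P j) L2dot f (e j) *: e j) ^+ 2 =
  L2norm f ^+ 2 - \sum_(0 <= j < n | P j) L2dot f (e j) ^+ 2.
Proof.
set S := (\sum_(0 <= j < n | P j) _ *: _).
have fS : L2dot f S = \sum_(0 <= j < n | P j) L2dot f (e j) ^+ 2.
  by rewrite /S L2dot_sumr; apply: eq_bigr => j _; rewrite L2dotZr expr2.
rewrite L2norm_sqr L2dotBl !L2dotBr (L2dotC S f) fS -L2norm_sqr -(L2norm_sqr S).
by rewrite L2norm_orthosum subrr subr0.
Qed.

Lemma Bessel f n :
  \sum_(0 <= j < n | P j) L2dot f (e j) ^+ 2 <= L2norm f ^+ 2.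
Proof. by rewrite -subr_ge0 -L2norm_orthosum_residual sqr_ge0. Qed.

(** By Pythagoras the distance between two partial sums is the square root of a
    slice of a bounded series of squares. *)
Lemma orthoseries_cvg (c : nat -> R) (C : R) :
  (forall n, \sum_(0 <= j < n | P j) c j ^+ 2 <= C) ->
  exists g : L2 mu,
    (fun n => L2norm (\sum_(0 <= j < n | P j) c j *: e j - g)) @ \oo --> 0.
Proof.
move=> cC; apply: L2_complete => eps eps0.
pose s n := \sum_(0 <= j < n | P j) c j ^+ 2.
have s_cat m n : (m <= n)%N -> s n = s m + \sum_(m <= j < n | P j) c j ^+ 2.
  by move=> mn; rewrite /s (big_cat_nat _ (n := m)).
have s_nd : nondecreasing_seq s.
  move=> m n mn; rewrite (s_cat _ _ mn) lerDl sumr_ge0// => j _.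
  exact: sqr_ge0.
have s_ub : has_ubound (range s) by exists C => _ [n _ <-]; exact: cC.
have s_cvg := nondecreasing_cvgn s_nd s_ub.
have [N _ NP] : \forall n \near \oo, `|sup (range s) - s n| <= eps ^+ 2.
  by move/cvgrPdist_le : s_cvg; apply; rewrite exprn_gt0.
have main m n : (N <= m)%N -> (m <= n)%N ->
    L2norm (\sum_(0 <= j < m | P j) c j *: e j -
            \sum_(0 <= j < n | P j) c j *: e j) <= eps.
  move=> Nm mn; rewrite L2normB (big_cat_nat _ (n := m) (p := n))//= addrAC subrr add0r.
  rewrite -ler_sqr ?nnegrE ?L2norm_ge0 ?(ltW eps0)// L2norm_orthosum.
  have -> : \sum_(m <= j < n | P j) c j ^+ 2 = s n - s m.
    by rewrite (s_cat _ _ mn) addrAC subrr add0r.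
  apply: le_trans (NP m Nm); apply: le_trans (ler_norm _); rewrite lerD2r.
  by apply: ub_le_sup => //; exists n.
exists N => m n Nm Nn; have [mn|/ltnW nm] := leqP m n; first exact: main.
by rewrite L2normB; exact: main.
Qed.

End orthonormal_series.

(** * Limits in norm and spectral calculus *)

Lemma cvgMl0 (R : realType) (u : nat -> R) k :
  u @ \oo --> 0 -> (fun n => k * u n) @ \oo --> 0.
Proof. by move=> u0; rewrite -(mulr0 k); exact: cvgMl_tmp. Qed.

Lemma cvgMr0 (R : realType) (u : nat -> R) k :
  u @ \oo --> 0 -> (fun n => u n * k) @ \oo --> 0.
Proof. by move=> u0; rewrite -(mul0r k); exact: cvgMr_tmp. Qed.

Section L2_limits.
Context (d : measure_display) (T : measurableType d) (R : realType).
Variables (mu : {measure set T -> \bar R}).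
Implicit Types (u v : nat -> L2 mu) (a b g : L2 mu).

Lemma L2dot_cvg u a g : (fun n => L2norm (u n - a)) @ \oo --> 0 ->
  (fun n => L2dot (u n) g) @ \oo --> L2dot a g.
Proof.
move=> ua; have ug : (fun n => L2norm (u n - a) * L2norm g) @ \oo --> 0.
  exact: cvgMr0.
apply/cvgrPdist_le => eps eps0; move/cvgr0Pnorm_le/(_ _ eps0) : ug.
apply: filterS => n; apply: le_trans; rewrite -L2dotBl L2normB.
by apply: le_trans (L2dot_CS _ _) _; rewrite ler_norm.
Qed.

Lemma L2norm_cvg u a : (fun n => L2norm (u n - a)) @ \oo --> 0 ->
  (fun n => L2norm (u n)) @ \oo --> L2norm a.
Proof.
move=> ua; apply/cvgrPdist_le => eps eps0; move/cvgr0Pnorm_le/(_ _ eps0) : ua.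
apply: filterS => n; apply: le_trans; apply: le_trans (ler_dist_L2norm _ _) _.
by rewrite L2normB ler_norm.
Qed.

Lemma L2cvgD u v a b :
  (fun n => L2norm (u n - a)) @ \oo --> 0 ->
  (fun n => L2norm (v n - b)) @ \oo --> 0 ->
  (fun n => L2norm (u n + v n - (a + b))) @ \oo --> 0.
Proof.
move=> ua vb; have uvab := cvgD ua vb; rewrite addr0 in uvab.
apply: squeeze_cvgr; [|exact: cvg_cst|exact: uvab]; apply: nearW => n.
by rewrite L2norm_ge0/= opprD addrACA ler_L2normD.
Qed.

Lemma L2cvgZ u a k :
  (fun n => L2norm (u n - a)) @ \oo --> 0 ->
  (fun n => L2norm (k *: u n - k *: a)) @ \oo --> 0.
Proof.
move=> ua; under eq_fun do rewrite -scalerBr L2normZ.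
exact: cvgMl0.
Qed.

End L2_limits.

Section spectral_calculus.
Context (d : measure_display) (T : measurableType d) (R : realType).
Variables (mu : {measure set T -> \bar R}) (mu_ : nat -> R) (e : nat -> L2 mu).
Hypothesis e_ortho : forall i j, 0 < mu_ i -> 0 < mu_ j ->
  L2dot (e i) (e j) = (i == j)%:R.

Lemma spectral_sumE h f n :
  spectral_sum mu_ e h f n =
  \sum_(0 <= j < n | 0 < mu_ j) (h (mu_ j) * L2dot f (e j)) *: e j
  + h 0 *: (f - \sum_(0 <= j < n | 0 < mu_ j) L2dot f (e j) *: e j).
Proof. by rewrite !big_mkord. Qed.

Lemma spectral_coef_bound h f (C : R) n : (forall j, 0 < mu_ j -> `|h (mu_ j)| <= C) ->
  \sum_(0 <= j < n | 0 < mu_ j) (h (mu_ j) * L2dot f (e j)) ^+ 2 <= C ^+ 2 * L2norm f ^+ 2.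
Proof.
move=> hC; apply: le_trans (ler_wpM2l (sqr_ge0 C) (Bessel e_ortho f n)).
rewrite mulr_sumr; apply: ler_sum => j Pj; rewrite exprMn.
apply: ler_wpM2r; first exact: sqr_ge0.
rewrite -(real_normK (num_real (h _))) ler_sqr ?nnegrE ?normr_ge0 ?hC//.
by apply: le_trans (hC j Pj); exact: normr_ge0.
Qed.

(** The limit is the projection of f onto the orthogonal of the eigenvectors. *)
Lemma residual_cvg f : exists g : L2 mu,
  (fun n => L2norm (f - \sum_(0 <= j < n | 0 < mu_ j) L2dot f (e j) *: e j - g)) @ \oo --> 0.
Proof.
have [g gP] := orthoseries_cvg e_ortho (Bessel e_ortho f).
exists (f - g); under eq_fun do rewrite opprB [X in L2norm X]addrC addrA subrK L2normB.
exact: gP.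
Qed.

(** spectral_fun is defined by choice among the limits of the partial sums and is
    0 when there is none; completeness of L^2 excludes the default value for
    every h bounded on the positive eigenvalues. *)
Lemma spectral_fun_cvg h f (C : R) : (forall j, 0 < mu_ j -> `|h (mu_ j)| <= C) ->
  (fun n => L2norm (spectral_sum mu_ e h f n - spectral_fun mu_ e h f)) @ \oo --> 0.
Proof.
move=> hC; rewrite /spectral_fun; case: xgetP => [g -> //|/=].
have [g1 g1P] := orthoseries_cvg e_ortho (fun n => spectral_coef_bound f n hC).
have [g2 g2P] := residual_cvg f.
move=> /(_ (g1 + h 0 *: g2)); case.
under eq_fun do rewrite spectral_sumE.
by apply: L2cvgD => //; exact: L2cvgZ.
Qed.

End spectral_calculus.

(** * Square-integrable functions on a product *)

Section L2_indicator.
Context (d : measure_display) (T : measurableType d) (R : realType).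
Variable mu : {measure set T -> \bar R}.

Lemma L2_indic (U : set T) : measurable U -> (mu U < +oo)%E ->
  {g : L2 mu | g = \1_U :> (T -> R)}.
Proof.
move=> mU Uoo; apply: L2_of_fun; first exact: measurable_indic.
rewrite (eq_integral (EFin \o \1_U)) => [|t _].
  by rewrite integral_indic// setIT.
by rewrite /= indicE; case: (_ \in _); rewrite ?expr1n ?expr0n.
Qed.

End L2_indicator.

Section L2_product.
Context (d1 d2 : measure_display) (X : measurableType d1) (T : measurableType d2).
Variables (R : realType) (m1 : {sigma_finite_measure set X -> \bar R})
  (m2 : {sigma_finite_measure set T -> \bar R}).
Implicit Types (f : L2 m2) (g : L2 m1).
Local Notation m12 := (m1 \x m2)%E.

Lemma measurable_tensor g f : measurable_fun [set: X * T] (fun z => g z.1 * f z.2).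
Proof. by apply: measurable_funM; apply: measurableT_comp. Qed.

Lemma tensor_sqr_lty g f :
  (\int[m12]_z ((g z.1 * f z.2) ^+ 2)%:E < +oo)%E.
Proof.
rewrite fubini_tonelli1/=; last 2 first.
- by apply/measurable_EFinP/measurable_funX; exact: measurable_tensor.
- by move=> z; rewrite lee_fin sqr_ge0.
rewrite (eq_integral (fun x => (g x ^+ 2 * L2norm f ^+ 2)%:E)).
  under eq_integral do rewrite mulrC EFinM.
  rewrite ge0_integralZl_EFin ?sqr_ge0//; first 1 last.
  - by move=> x _; rewrite lee_fin sqr_ge0.
  - by apply/measurable_EFinP/measurable_funX.
  by rewrite -L2norm_sqrE -EFinM ltry.
move=> x _; rewrite EFinM L2norm_sqrE /fubini_F/=.
under eq_integral do rewrite exprMn EFinM.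
rewrite ge0_integralZl_EFin ?sqr_ge0//.
- by move=> t _; rewrite lee_fin sqr_ge0.
- by apply/measurable_EFinP/measurable_funX.
Qed.

Definition tensor g f : L2 m12 :=
  sval (L2_of_fun (measurable_tensor g f) (tensor_sqr_lty g f)).

Lemma tensorE g f z : tensor g f z = g z.1 * f z.2.
Proof. by rewrite /tensor; case: L2_of_fun => h /= ->. Qed.

Lemma L2dot_tensorr (K : L2 m12) g f :
  ((L2dot K (tensor g f))%:E =
   \int[m1]_x \int[m2]_t (K (x, t) * (g x * f t))%:E)%E.
Proof.
rewrite L2dotE -integral12_prod_meas1; last exact: L2_mulr_integrable.
by apply: eq_integral => x _; apply: eq_integral => t _; rewrite tensorE.
Qed.

Lemma L2dot_tensor g f g' f' :
  L2dot (tensor g f) (tensor g' f') = L2dot g g' * L2dot f f'.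
Proof.
apply: EFin_inj; rewrite L2dot_tensorr.
rewrite (eq_integral (fun x => ((L2dot f f')%:E * (g x * g' x)%:E)%E)).
  rewrite integralZl//; last exact: L2_mulr_integrable.
  by rewrite -L2dotE -EFinM mulrC.
move=> x _; rewrite L2dotE muleC -integralZl//; last exact: L2_mulr_integrable.
by apply: eq_integral => t _; rewrite tensorE -EFinM /= mulrACA.
Qed.

(** The factors may fail to be separable, so tensors of countable orthonormal bases
    do not exist in general.  Orthogonality to the tensors of indicators says
    that K has integral 0 on every measurable rectangle inside a set
    D k = F k * G k of finite measure, where K is integrable; Dynkin's theorem
    extends this to all measurable subsets of D k, and the D k exhaust the
    product. *)
Lemma L2_prod_eq0 (K : L2 m12) :
  (forall g f, L2dot K (tensor g f) = 0) -> L2norm K = 0.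
Proof.
move=> K0.
have /sigma_finiteP[F [FT Fnd Foo]] := sigma_finiteT m1.
have /sigma_finiteP[G [GT Gnd Goo]] := sigma_finiteT m2.
pose D k := F k `*` G k.
have mD k : measurable (D k) by apply: measurableX; [exact: (Foo k).1|exact: (Goo k).1].
have Doo k : (m12 (D k) < +oo)%E.
  rewrite product_measure1E; [|exact: (Foo k).1|exact: (Goo k).1].
  by rewrite lte_mul_pinfty ?ge0_fin_numE ?(Foo k).2 ?(Goo k).2.
have iK k : m12.-integrable (D k) (EFin \o K).
  have [h hE] := L2_indic (mD k) (Doo k).
  have := L2_mulr_integrable K h.
  rewrite (_ : (fun t => _) = (EFin \o K) \_ (D k)); last first.
    apply/funext => z; rewrite hE patchE indicE.
    by case: ifPn => _; rewrite ?mulr1 ?mulr0.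
  by move=> H; apply/(integrable_mkcond _ (mD k)).
pose Q k := [set E : set (X * T) | (\int[m12]_(z in D k `&` E) (K z)%:E = 0)%E].
have Qrect k U V : measurable U -> measurable V -> Q k (U `*` V).
  move=> mU mV.
  have mFU : measurable (F k `&` U) by apply: measurableI => //; exact: (Foo k).1.
  have mGV : measurable (G k `&` V) by apply: measurableI => //; exact: (Goo k).1.
  have FUoo : (m1 (F k `&` U) < +oo)%E.
    by apply: le_lt_trans (Foo k).2; rewrite le_measure ?inE//; exact: (Foo k).1.
  have GVoo : (m2 (G k `&` V) < +oo)%E.
    by apply: le_lt_trans (Goo k).2; rewrite le_measure ?inE//; exact: (Goo k).1.
  have [g gE] := L2_indic mFU FUoo; have [f fE] := L2_indic mGV GVoo.
  have := congr1 EFin (K0 g f); rewrite L2dotE => K1.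
  rewrite /Q/= integral_mkcond -[RHS]K1; apply: eq_integral => z _.
  rewrite tensorE gE fE patchE /D -setXI.
  rewrite !indicE; case: ifPn; rewrite ?in_setX.
    by move=> /andP[-> ->]; rewrite !mulr1.
  by rewrite negb_and => /orP[/negPf->|/negPf->]; rewrite ?mulr0 ?mul0r ?mulr0.
have QT k : Q k setT by rewrite -setXTT; exact: Qrect.
have Qm k E : measurable E -> Q k E.
  rewrite measurable_prod_measurableType; apply: dynkin_induction => //.
  - by rewrite measurable_prod_measurableType.
  - move=> _ _ [A1 mA1 [A2 mA2 <-]] [B1 mB1 [B2 mB2 <-]].
    exists (A1 `&` B1); first exact: measurableI.
    exists (A2 `&` B2); first exact: measurableI.
    by rewrite setXI.
  - by move=> _ [A mA [B mB <-]]; exact: Qrect.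
  - move=> S mS QS; have := QT k; rewrite /Q/= -(setUv S) setIUr.
    rewrite integral_setU//; first by rewrite [X in (X + _)%E]QS add0e.
    + exact: measurableI.
    + by apply: measurableI => //; exact: measurableC.
    + by rewrite -setIUr setUv setIT; apply/measurable_EFinP; apply: measurable_funTS.
    + by rewrite disj_set2E setIACA setICr setI0.
  - move=> H mH tH QH; rewrite /Q/= setI_bigcupr integral_bigcup.
    + by rewrite eseries0// => i _ _; exact: QH.
    + by apply/trivIset_setIl.
    + by move=> n; exact: measurableI.
    + rewrite -setI_bigcupr; apply: integrableS (iK k) => //.
      by apply: measurableI => //; exact: bigcupT_measurable.
have aeD k : ae_eq m12 (D k) (EFin \o K) (cst 0%E).
  apply: integral_ae_eq => // E ED mE.
  by rewrite integral0; have := Qm k E mE; rewrite /Q/= setIidr.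
apply: L2norm_ae_eq0.
have := ae_foralln aeD; apply: filterS => -[x t] /= H _.
have [i _ Fi] : (\bigcup_i F i) x by rewrite -FT.
have [j _ Gj] : (\bigcup_i G i) t by rewrite -GT.
have DD : D (maxn i j) (x, t).
  split=> /=.
    by move: Fi; apply/subsetPset/Fnd; rewrite leq_maxl.
  by move: Gj; apply/subsetPset/Gnd; rewrite leq_maxr.
by case: (H _ DD).
Qed.

End L2_product.

(** * Expansion of the kernel along the eigenvectors *)

Section spectral_operator.
Context (d1 d2 : measure_display) (T : measurableType d1)
  (X : measurableType d2) (R : realType).
Variables (mu : {measure set T -> \bar R}) (nu : {measure set X -> \bar R}).
Variables (A : L2 mu -> L2 nu) (Astar : L2 nu -> L2 mu).
Hypothesis hAstar : is_adjoint A Astar.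
Variables (mu_ : nat -> R) (e : nat -> L2 mu).
Hypothesis he : eigensystem (Astar \o A) mu_ e.

Lemma L2dot_image_eigenvector f j : 0 < mu_ j ->
  L2dot (A f) (A (e j)) = mu_ j * L2dot f (e j).
Proof.
move=> j0; rewrite hAstar -L2dotZr !(L2dotC f); apply: L2dot_eq_dist.
by apply: L2norm_ae_eq; exact: (eigenvectorE he j0).
Qed.

Lemma image_eigenvector_ortho i j : 0 < mu_ i -> 0 < mu_ j ->
  L2dot (A (e i)) (A (e j)) = mu_ j * (i == j)%:R.
Proof. by move=> i0 j0; rewrite L2dot_image_eigenvector// (eigenvector_ortho he). Qed.

(** If f is orthogonal to the eigenvectors then A^* A f = 0, and the squared norm
    of A f is the inner product of f with A^* A f. *)
Lemma ker_orthogonal_eigenvectors f :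
  (forall j, 0 < mu_ j -> L2dot f (e j) = 0) -> L2norm (A f) = 0.
Proof.
move=> /(eigenvector_complete he) Bf0; apply/eqP; rewrite -sqrf_eq0 L2norm_sqr.
by rewrite hAstar L2dotC (L2dot_norm0 _ (L2norm_ae_eq0 Bf0)).
Qed.

(** A bounded inverse of B - mu_j would send the null vector B e_j - mu_j e_j
    to the unit vector e_j. *)
Lemma eigenvalue_in_spectrum j : 0 < mu_ j -> spectrum (Astar \o A) (mu_ j).
Proof.
move=> j0 [S [M SM] /(_ (e j))[Se _]].
have : L2norm (e j) = 0.
  rewrite -(L2norm_eq_dist (L2norm_ae_eq Se)); apply/eqP.
  rewrite eq_le L2norm_ge0 andbT; apply: le_trans (SM _) _.
  by rewrite (L2norm_ae_eq (eigenvectorE he j0)) mulr0.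
move/(congr1 (fun x => x ^+ 2)); rewrite L2norm_sqr (eigenvector_ortho he)//.
by rewrite eqxx expr0n => /eqP; rewrite oner_eq0.
Qed.

End spectral_operator.

Section kernel_expansion.
Context (d1 d2 : measure_display) (T : measurableType d1)
  (X : measurableType d2) (R : realType).
Variables (mu : {sigma_finite_measure set T -> \bar R}) (nu : probability X R).
Variables (phi : X -> L2 mu) (A : {linear L2 mu -> L2 nu}).
Hypothesis hA : kernel_operator phi A.
Variable (Astar : L2 nu -> L2 mu).
Hypothesis hAstar : is_adjoint A Astar.
Variables (mu_ : nat -> R) (e : nat -> L2 mu).
Hypothesis he : eigensystem (Astar \o A) mu_ e.

Let e_ortho := eigenvector_ortho he.

Lemma phi_dotE f x : L2dot (phi x) f = A f x.
Proof. by rewrite L2dotC (operator_kernel hA). Qed.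

(** Apply the pointwise bound on A to f = phi x, at the point x itself. *)
Lemma L2norm_phi_le : exists2 c : R, 0 < c & forall x, L2norm (phi x) <= c.
Proof.
have [c c0 cP] := operator_pointwise hA; exists c => // x.
have := cP (phi x) x; rewrite -phi_dotE -L2norm_sqr ger0_norm ?sqr_ge0//.
have [->|n0] := eqVneq (L2norm (phi x)) 0; first by move=> _; rewrite ltW.
by rewrite expr2 ler_pM2r// lt_neqAle eq_sym n0 L2norm_ge0.
Qed.

(** The residual of f converges to a vector orthogonal to all eigenvectors, which
    A annihilates. *)
Lemma image_residual_cvg0 f g :
  (fun n => L2dot (A (f - \sum_(0 <= j < n | 0 < mu_ j) L2dot f (e j) *: e j)) g)
    @ \oo --> 0.
Proof.
have [f0 f0P] := residual_cvg e_ortho f.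
have [M MP] := operator_bounded hA.
have f0e j : 0 < mu_ j -> L2dot f0 (e j) = 0.
  move=> Pj; have := L2dot_cvg (g := e j) f0P.
  have cv0 : (fun n => L2dot (f - \sum_(0 <= j < n | 0 < mu_ j) L2dot f (e j) *: e j)
      (e j)) @ \oo --> 0.
    apply: cvg_near_cst; exists j.+1 => // n /= jn.
    by rewrite L2dotBl (L2dot_orthosum e_ortho _ Pj)// subrr.
  by move/(cvg_lim (@norm_hausdorff _ _)) <-; apply: (cvg_lim (@norm_hausdorff _ _)).
have Af0 : L2norm (A f0) = 0 by apply: (ker_orthogonal_eigenvectors hAstar he).
have cv : (fun n => M * L2norm (f - \sum_(0 <= j < n | 0 < mu_ j) L2dot f (e j) *: e j - f0)
      * L2norm g) @ \oo --> 0.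
  by apply: cvgMr0; exact: cvgMl0.
apply/norm_cvg0P; apply: squeeze_cvgr; [|exact: cvg_cst|exact: cv].
apply: nearW => n; rewrite normr_ge0/=.
set r := f - _; rewrite -(subrK f0 r) linearD L2dotDl (L2dot_norm0 _ Af0) addr0.
apply: le_trans (L2dot_CS _ _) _; rewrite addrK.
by apply: ler_wpM2r; [exact: L2norm_ge0|exact: MP].
Qed.

Lemma measurable_L2norm_phi : measurable_fun setT (fun x => L2norm (phi x) ^+ 2).
Proof.
apply/measurable_EFinP; rewrite /comp; under eq_fun do rewrite L2norm_sqrE.
apply: (measurable_fun_fubini_tonelli_F (fun z => ((phi z.1 z.2) ^+ 2)%:E)) => /=.
  by apply/measurable_EFinP/measurable_funX; exact: (kernel_measurable hA).
by move=> z; rewrite lee_fin sqr_ge0.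
Qed.

Lemma phi_sqr_lty : (\int[nu \x mu]_z ((phi z.1 z.2) ^+ 2)%:E < +oo)%E.
Proof.
have [c c0 cP] := L2norm_phi_le.
rewrite fubini_tonelli1/=; last 2 first.
- by apply/measurable_EFinP/measurable_funX; exact: (kernel_measurable hA).
- by move=> z; rewrite lee_fin sqr_ge0.
rewrite /fubini_F/=; under eq_integral do rewrite -L2norm_sqrE.
apply: (@le_lt_trans _ _ (\int[nu]_x (c ^+ 2)%:E)%E).
  apply: ge0_le_integral => //.
  - by move=> x _; rewrite lee_fin sqr_ge0.
  - by apply/measurable_EFinP; exact: measurable_L2norm_phi.
  - by move=> x _; rewrite lee_fin ler_sqr ?nnegrE ?L2norm_ge0// ltW.
rewrite integral_cst// [X in (_ * X)%E](_ : _ = 1%E) ?mule1 ?ltry//.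
exact: (@probability_setT _ _ _ nu).
Qed.

(** The kernel phi as a vector of L^2(nu x mu). *)
Let K := sval (L2_of_fun (kernel_measurable hA) phi_sqr_lty).

Let KE z : K z = phi z.1 z.2.
Proof. by rewrite /K; case: L2_of_fun => h /= ->. Qed.

Let K_tensor g f : L2dot K (tensor g f) = L2dot (A f) g.
Proof.
apply: EFin_inj; rewrite L2dot_tensorr L2dotE; apply: eq_integral => x _.
rewrite -phi_dotE EFinM L2dotE muleC -integralZl//; last exact: L2_mulr_integrable.
by apply: eq_integral => t _; rewrite KE/= -EFinM mulrCA.
Qed.

(** The functions (A e_j)(x) e_j(t) / sqrt mu_j are orthonormal in L^2(nu x mu), and
    the expansion of phi along them is, at each x, the expansion of phi x along
    the e_j.  Its residual has a limit Psi.  The inner product of Psi with a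
    tensor of g and f is the limit of the inner products of A (residual of f)
    with g, hence 0; so Psi = 0, and by Tonelli the squared norm of the residual
    is the integral below. *)
Lemma kernel_residual_cvg0 :
  (fun n => \int[nu]_x (L2norm (phi x -
     \sum_(0 <= j < n | 0 < mu_ j) L2dot (phi x) (e j) *: e j) ^+ 2)%:E)%E
  @ \oo --> 0%E.
Proof.
pose u j := (Num.sqrt (mu_ j))^-1 *: tensor (A (e j)) (e j).
have u_ortho i j : 0 < mu_ i -> 0 < mu_ j -> L2dot (u i) (u j) = (i == j)%:R.
  move=> Pi Pj; rewrite L2dotZl L2dotZr L2dot_tensor.
  rewrite (image_eigenvector_ortho hAstar he)// e_ortho//.
  have [->|ij] := eqVneq i j; last by rewrite !mulr0.
  rewrite !mulr1 mulrA -invfM -expr2 sqr_sqrtr ?ltW// mulVf// gt_eqF//.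
have Ku j : 0 < mu_ j -> L2dot K (u j) = Num.sqrt (mu_ j).
  move=> Pj; rewrite L2dotZr K_tensor (image_eigenvector_ortho hAstar he)// eqxx mulr1.
  by rewrite -{2}(sqr_sqrtr (ltW Pj)) expr2 mulKf// gt_eqF// sqrtr_gt0.
pose r n := K - \sum_(0 <= j < n | 0 < mu_ j) L2dot K (u j) *: u j.
have rE n z : r n z = (phi z.1 - \sum_(0 <= j < n | 0 < mu_ j) L2dot (phi z.1) (e j) *: e j) z.2.
  rewrite -[LHS]/(K z - (\sum_(0 <= j < n | 0 < mu_ j) L2dot K (u j) *: u j) z) KE.
  rewrite -[RHS]/(phi z.1 z.2 - (\sum_(0 <= j < n | 0 < mu_ j) L2dot (phi z.1) (e j) *: e j) z.2).
  congr (_ - _); rewrite !L2_sumE; apply: eq_bigr => j Pj.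
  rewrite !L2ZE tensorE phi_dotE Ku// mulrA mulfV ?mul1r//.
  by rewrite gt_eqF// sqrtr_gt0.
have [Psi PsiP] := residual_cvg u_ortho K.
have Psi0 : L2norm Psi = 0.
  apply: L2_prod_eq0 => g f.
  have rg n : L2dot (r n) (tensor g f) =
      L2dot (A (f - \sum_(0 <= j < n | 0 < mu_ j) L2dot f (e j) *: e j)) g.
    rewrite linearB linear_sum/= !L2dotBl K_tensor !L2dot_suml; congr (_ - _).
    apply: eq_bigr => j Pj; rewrite (linearZ_LR A) !L2dotZl Ku//.
    rewrite L2dot_tensor mulVKf; last by rewrite gt_eqF// sqrtr_gt0.
    by rewrite mulrC (L2dotC f).
  have := L2dot_cvg (g := tensor g f) PsiP.
  move/(cvg_lim (@norm_hausdorff _ _)) <-; apply: (cvg_lim (@norm_hausdorff _ _)).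
  by rewrite -/r; under eq_fun do rewrite rg; exact: image_residual_cvg0.
have rcv : (fun n => L2norm (r n) ^+ 2) @ \oo --> 0.
  by have := cvgM (L2norm_cvg PsiP) (L2norm_cvg PsiP); rewrite Psi0 mulr0; exact.
have rint n : ((L2norm (r n) ^+ 2)%:E = \int[nu]_x (L2norm (phi x -
     \sum_(0 <= j < n | 0 < mu_ j) L2dot (phi x) (e j) *: e j) ^+ 2)%:E)%E.
  rewrite L2norm_sqrE fubini_tonelli1/=; last 2 first.
  - by apply/measurable_EFinP/measurable_funX.
  - by move=> z; rewrite lee_fin sqr_ge0.
  apply: eq_integral => x _; rewrite L2norm_sqrE; apply: eq_integral => t _.
  by congr ((_ ^+ 2)%:E); exact: (rE n (x, t)).
by under eq_fun do rewrite -rint; apply: cvg_EFin => //; exact: nearW.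
Qed.

(** For a fixed f in the kernel of A, f is orthogonal to phi x for almost every x,
    but the null set depends on f; the convergence in L^2(nu x mu) provides one
    null set for all.  The squared residuals decrease with n, so their limit q
    has integral 0 and vanishes almost everywhere. *)
Lemma kernel_expansion : {ae nu, forall x, (fun n => L2norm (phi x -
     \sum_(0 <= j < n | 0 < mu_ j) L2dot (phi x) (e j) *: e j)) @ \oo --> 0}.
Proof.
pose s n x := \sum_(0 <= j < n | 0 < mu_ j) L2dot (phi x) (e j) ^+ 2.
pose p n x := L2norm (phi x -
  \sum_(0 <= j < n | 0 < mu_ j) L2dot (phi x) (e j) *: e j) ^+ 2.
have pE n x : p n x = L2norm (phi x) ^+ 2 - s n x.
  by rewrite /p (L2norm_orthosum_residual e_ortho).
have s_cvg x : cvgn (s ^~ x).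
  apply: nondecreasing_is_cvgn.
    apply/nondecreasing_seqP => n; rewrite /s big_mkcond [leRHS]big_mkcond.
    rewrite big_nat_recr//= lerDl; case: ifP => // _; exact: sqr_ge0.
  exists (L2norm (phi x) ^+ 2) => _ [n _ <-]; exact: (Bessel e_ortho).
have p_cvg x : cvgn (p ^~ x).
  rewrite (_ : p ^~ x = fun n => L2norm (phi x) ^+ 2 - s n x); last first.
    by apply/funext => n; exact: pE.
  apply: is_cvgB => //; exact: is_cvg_cst.
have mp n : measurable_fun setT (p n).
  rewrite (_ : p n = fun x => L2norm (phi x) ^+ 2 - s n x); last first.
    by apply/funext => x; exact: pE.
  apply: measurable_funB; first exact: measurable_L2norm_phi.
  rewrite (_ : s n = fun x => \sum_(0 <= j < n) if 0 < mu_ j then A (e j) x ^+ 2 else 0).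
    apply: measurable_sum => j; case: (0 < mu_ j) => //; exact: measurable_funX.
  apply/funext => x; rewrite /s big_mkcond; apply: eq_bigr => j _.
  by rewrite phi_dotE.
pose q x := limn (p ^~ x).
have q0 x : 0 <= q x by apply: limr_ge => //; apply: nearW => n; exact: sqr_ge0.
have qp n x : q x <= p n x.
  apply: limr_le => //; exists n => // m /= nm; rewrite !pE lerD2l lerN2.
  rewrite /s (big_cat_nat _ (n := n) (p := m))//= lerDl.
  by apply: sumr_ge0 => j _; exact: sqr_ge0.
have mq : measurable_fun setT q.
  by apply: (measurable_fun_cvg (h := p)) => // x _; exact: p_cvg.
have iq : (\int[nu]_x (q x)%:E = 0)%E.
  apply/eqP; rewrite eq_le integral_ge0 ?andbT; last by move=> x _; rewrite lee_fin.
  rewrite -(cvg_lim _ kernel_residual_cvg0)//; apply: lime_ge.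
    by apply/cvg_ex; eexists; exact: kernel_residual_cvg0.
  apply: nearW => n; apply: ge0_le_integral => //.
  - by move=> x _; rewrite lee_fin.
  - exact/measurable_EFinP.
  - by apply/measurable_EFinP; exact: mp.
  - by move=> x _; rewrite lee_fin; exact: qp.
have : ae_eq nu setT (EFin \o q) (cst 0%E).
  apply/(ae_eq_integral_abs _ measurableT); first exact/measurable_EFinP.
  by rewrite -[RHS]iq; apply: eq_integral => x _; rewrite /= ger0_norm.
apply: filterS => x /= /(_ I) [qx0].
have : p ^~ x @ \oo --> q x by exact: p_cvg.
rewrite qx0 => /cvgrPdist_lt px; apply/cvgrPdist_lt => eps eps0.
have := px (eps ^+ 2); rewrite exprn_gt0// => /(_ isT); apply: filterS => n.
rewrite !sub0r !normrN !ger0_norm ?L2norm_ge0 ?sqr_ge0// /p.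
by rewrite ltr_sqr ?nnegrE ?L2norm_ge0// ltW.
Qed.

End kernel_expansion.

(** * Conditional expectation against bounded functions *)

Lemma integrable_bounded_mul (d1 : measure_display) (T1 : measurableType d1)
  (R : realType) (m1 : {measure set T1 -> \bar R}) 
  (Z g : T1 -> R) (C : R) :
  m1.-integrable setT (EFin \o Z) -> measurable_fun setT g ->
  (forall t, `|g t| <= C) -> m1.-integrable setT (fun t => (Z t * g t)%:E).
Proof.
move=> iZ mg gC; have mZ : measurable_fun setT Z.
  by apply/measurable_EFinP; exact: measurable_int iZ.
apply: (le_integrable measurableT _ _ (integrableZl measurableT C iZ)).
  by apply/measurable_EFinP; exact: measurable_funM.
move=> t _; rewrite /= lee_fin !normrM mulrC ler_wpM2r//.
by apply: le_trans (gC t) _; exact: ler_norm.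
Qed.

Section bounded_multiplier.
Context (d1 d2 : measure_display) (T1 : measurableType d1)
  (T2 : measurableType d2) (R : realType).
Variables (m1 : {measure set T1 -> \bar R}) (m2 : {measure set T2 -> \bar R}).
Variables (p : T1 -> T2) (mp : measurable_fun setT p) (Z : T1 -> R) (h : T2 -> R).
Hypotheses (iZ : m1.-integrable setT (EFin \o Z))
  (ih : m2.-integrable setT (EFin \o h)).
Hypothesis Zh : forall U, measurable U ->
  (\int[m1]_(z in p @^-1` U) (Z z)%:E = \int[m2]_(x in U) (h x)%:E)%E.

Let mulE (g : T2 -> R) :=
  (\int[m1]_z (Z z * g (p z))%:E = \int[m2]_x (h x * g x)%:E)%E.

Let mulE_indic U : measurable U -> mulE \1_U.
Proof.
move=> mU; rewrite /mulE; have := Zh mU.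
rewrite integral_mkcond [RHS]integral_mkcond => E.
transitivity (\int[m1]_x ((fun z => (Z z)%:E) \_ (p @^-1` U)) x)%E.
  apply: eq_integral => z _; rewrite patchE indicE.
  rewrite (_ : (p z \in U) = (z \in p @^-1` U)).
    by case: ifPn => _; rewrite ?mulr1 ?mulr0.
  by apply/idP/idP; rewrite !inE.
rewrite E; apply: eq_integral => x _; rewrite patchE indicE.
by case: ifPn => _; rewrite ?mulr1 ?mulr0.
Qed.

Import HBNNSimple.

Let mulE_nnsfun (g : {nnsfun T2 >-> R}) : mulE g.
Proof.
rewrite /mulE; pose s : seq R := finmap.enum_fset (fset_set (g @` setT)).
pose B i := g @^-1` [set s`_i].
have mB i : measurable (B i) by rewrite -[B i]setTI; exact: measurable_funP.
have mpB i : measurable_fun setT (\1_(B i) \o p : T1 -> R).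
  by apply: measurableT_comp => //; exact: measurable_indic.
have indic1 i x : `|\1_(B i) x : R| <= 1.
  by rewrite indicE; case: (_ \in _); rewrite ?normr1 ?normr0.
have i1 i : m1.-integrable setT (fun z => (Z z * \1_(B i) (p z))%:E).
  by apply: (integrable_bounded_mul (C := 1) iZ (mpB i)) => z; exact: indic1.
have i2 i : m2.-integrable setT (fun x => (h x * \1_(B i) x)%:E).
  apply: (integrable_bounded_mul (C := 1) ih) => [|z]; last exact: indic1.
  exact: measurable_indic.
transitivity (\sum_(i < size s) \int[m1]_z ((s`_i)%:E * (Z z * \1_(B i) (p z))%:E))%E.
  rewrite -integral_sum//; last by move=> i; exact: integrableZl.
  apply: eq_integral => z _.
  rewrite fimfunEord mulr_sumr -sumEFin; apply: eq_bigr => i _.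
  by rewrite -EFinM mulrCA.
transitivity (\sum_(i < size s) \int[m2]_x ((s`_i)%:E * (h x * \1_(B i) x)%:E))%E.
  by apply: eq_bigr => i _; rewrite !integralZl// mulE_indic.
rewrite -integral_sum//; last by move=> i; exact: integrableZl.
apply: eq_integral => x _.
rewrite fimfunEord mulr_sumr -sumEFin; apply: eq_bigr => i _.
by rewrite -EFinM mulrCA.
Qed.

Let mulE_ge0 (g : T2 -> R) (C : R) : measurable_fun setT g -> (forall x, 0 <= g x <= C) -> mulE g.
Proof.
move=> mg gC.
have mEg : measurable_fun setT (EFin \o g) by exact/measurable_EFinP.
pose f := nnsfun_approx measurableT mEg.
have g0 x : setT x -> (0 <= (EFin \o g) x)%E by move=> _; rewrite lee_fin; case/andP: (gC x).
have fcvg x : EFin \o f ^~ x @ \oo --> (g x)%:E by exact: cvg_nnsfun_approx.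
have fC n x : `|f n x| <= C.
  rewrite ger0_norm ?fun_ge0//; apply: le_trans (proj2 (andP (gC x))).
  rewrite -lee_fin /f nnsfun_approxE; exact: le_approx.
have cvg_dom d (T : measurableType d) (m : {measure set T -> \bar R}) (W : T -> R)
    (u : T -> T2) : measurable_fun setT u -> m.-integrable setT (EFin \o W) ->
  (fun n => \int[m]_z (W z * f n (u z))%:E)%E @ \oo --> (\int[m]_z (W z * g (u z))%:E)%E.
  move=> mu iW; have mW : measurable_fun setT W.
    by apply/measurable_EFinP; exact: measurable_int iW.
  have [|||||_ _ c] := @dominated_convergence _ _ _ m _ measurableT
    (fun n z => (W z * f n (u z))%:E) (fun z => (W z * g (u z))%:E)
    (fun z => (C%:E * `|(W z)%:E|)%E); last exact: c.
  - move=> n; apply/measurable_EFinP; apply: measurable_funM => //.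
    by apply: measurableT_comp => //; exact: measurable_funP.
  - apply/measurable_EFinP; apply: measurable_funM => //.
    exact: measurableT_comp.
  - apply: aeW => z _; have := fcvg (u z) => fz.
    under eq_fun do rewrite EFinM; rewrite EFinM; exact: cvgeZl.
  - by apply: integrableZl => //; exact: integrable_abse.
  - apply: aeW => z n _; rewrite lee_fin normrM mulrC ler_wpM2r//.
have c1 := cvg_dom _ _ m1 Z p mp iZ.
have c2 := cvg_dom _ _ m2 h id (@measurable_id _ _ _) ih.
rewrite /mulE -(cvg_lim (@ereal_hausdorff _) c1).
apply: (cvg_lim (@ereal_hausdorff _)); rewrite (_ : (fun n => _) =
  (fun n => \int[m2]_x (h x * f n x)%:E)%E)//.
by apply/funext => n; exact: mulE_nnsfun.
Qed.

(** The defining property of a conditional expectation concerns indicators only.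
    It passes to simple functions by linearity, to bounded nonnegative functions
    by dominated convergence, and to g by adding the constant C. *)
Lemma integral_bounded_multiplier (g : T2 -> R) (C : R) :
  measurable_fun setT g -> (forall x, `|g x| <= C) ->
  (\int[m1]_z (Z z * g (p z))%:E = \int[m2]_x (h x * g x)%:E)%E.
Proof.
move=> mg gC.
have mpg : measurable_fun setT (g \o p) by exact: measurableT_comp.
have C1 : mulE (fun x => g x + C).
  apply: (@mulE_ge0 _ (C + C)); first exact: measurable_funD.
  by move=> x; have := gC x; rewrite ler_norml => /andP[? ?]; apply/andP; split; lra.
have C2 : mulE (cst C).
  apply: (@mulE_ge0 _ C) => // x; rewrite lexx andbT.
  by apply: le_trans (gC x); exact: normr_ge0.
have i1 : m1.-integrable setT (fun z => (Z z * g (p z))%:E).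
  by apply: (integrable_bounded_mul (C := C)) => // z; exact: gC.
have i2 : m2.-integrable setT (fun x => (h x * g x)%:E).
  by apply: (integrable_bounded_mul (C := C)).
have j1 : m1.-integrable setT (fun z => (Z z * C)%:E).
  exact: (integrable_bounded_mul (C := `|C|)).
have j2 : m2.-integrable setT (fun x => (h x * C)%:E).
  exact: (integrable_bounded_mul (C := `|C|)).
move: C1; rewrite /mulE; under eq_integral do rewrite mulrDr EFinD.
under [in RHS]eq_integral do rewrite mulrDr EFinD.
rewrite !integralD// C2.
move=> /(congr1 (fun u => u - \int[m2]_x (h x * C)%:E)%E).
by rewrite !addeK//; exact: integrable_fin_num.
Qed.

End bounded_multiplier.

(** * Independent samples *)

Lemma integral_probability_cst (d : measure_display) (T : measurableType d)
  (R : realType) (P : probability T R) (k : \bar R) : (\int[P]_z k = k)%E.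
Proof.
rewrite integral_cst// [X in (_ * X)%E](_ : _ = 1%E) ?mule1//.
exact: (@probability_setT _ _ _ P).
Qed.

Section iid_samples.
Context (d : measure_display) (T : measurableType d) (R : realType).
Variable rho : probability T R.

Lemma ge0_integral_product_powerS n (f : n.+1.-tuple T -> \bar R) :
  measurable_fun setT f -> (forall z, 0 <= f z)%E ->
  (\int[product_power rho n.+1]_z f z =
   \int[rho]_z \int[product_power rho n]_w f (Defs.cons_tuple (z, w)))%E.
Proof.
move=> mf f0; rewrite ge0_integral_distribution// fubini_tonelli1//.
- by apply: measurableT_comp => //; exact: Defs.measurable_cons_tuple.
- by move=> z; exact: f0.
Qed.

Lemma integral_product_power_tnth n (i : 'I_n) (f : T -> \bar R) :
  measurable_fun setT f -> (forall z, 0 <= f z)%E ->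
  (\int[product_power rho n]_z f (tnth z i) = \int[rho]_z f z)%E.
Proof.
move=> mf f0; elim: n i => [[]//|n IH] i.
rewrite ge0_integral_product_powerS//; last first.
  by apply: measurableT_comp => //; exact: measurable_tnth.
have [j ->|->] := unliftP ord0 i.
  under eq_integral do under eq_integral do rewrite tnthS.
  under eq_integral do rewrite IH.
  by rewrite integral_probability_cst.
under eq_integral do under eq_integral do rewrite tnth0.
by apply: eq_integral => z _; rewrite /= integral_probability_cst.
Qed.

Lemma sum_tnthS n (xi : T -> R) z (w : n.-tuple T) :
  \sum_(i < n.+1) xi (tnth (Defs.cons_tuple (z, w)) i) = xi z + \sum_(i < n) xi (tnth w i).
Proof.
rewrite big_ord_recl/= tnth0; congr (_ + _).
by apply: eq_bigr => i _; rewrite tnthS.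
Qed.

Lemma measurable_sum_tnth n (xi : T -> R) : measurable_fun setT xi ->
  measurable_fun setT (fun z : n.-tuple T => \sum_(i < n) xi (tnth z i)).
Proof.
move=> mxi; apply: measurable_sum => i.
by apply: measurableT_comp => //; exact: measurable_tnth.
Qed.

(** The variance of a sum of independent centred variables, with a free
    constant b: integrating out the other coordinates first leaves the square of
    b + xi z, to which the hypothesis applies, so that the induction is an
    application of Tonelli's theorem to nonnegative integrands.  The hypothesis on
    xi says that it is centred with variance v. *)
Lemma integral_sqr_sum_tnth (xi : T -> R) (v : R) : measurable_fun setT xi -> 0 <= v ->
  (forall b, \int[rho]_z ((b + xi z) ^+ 2)%:E = (b ^+ 2 + v)%:E)%E ->
  forall n b, (\int[product_power rho n]_z ((b + \sum_(i < n) xi (tnth z i)) ^+ 2)%:E =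
    (b ^+ 2 + n%:R * v)%:E)%E.
Proof.
move=> mxi v0 xiv; elim=> [|n IH] b.
  under eq_integral do rewrite big_ord0 addr0.
  by rewrite mul0r addr0 integral_probability_cst.
rewrite ge0_integral_product_powerS//.
- under eq_integral do under eq_integral do rewrite sum_tnthS addrA.
  under eq_integral do rewrite IH EFinD.
  rewrite ge0_integralD//=.
  + rewrite xiv integral_probability_cst -EFinD.
    by congr (_%:E); rewrite -natr1; ring.
  + by move=> z _; rewrite lee_fin sqr_ge0.
  + by apply/measurable_EFinP/measurable_funX; apply: measurable_funD.
  + by move=> z _; rewrite lee_fin mulr_ge0.
- apply/measurable_EFinP/measurable_funX; apply: measurable_funD => //.
  exact: measurable_sum_tnth.
- by move=> z; rewrite lee_fin sqr_ge0.
Qed.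

End iid_samples.

(** * Moments of the observations *)

Section conditional_moments.
Context (d : measure_display) (X : measurableType d) (R : realType).
Variables (rho : probability (X * R)%type R) (nu : probability X R).
Hypothesis hnu : forall U : set X, measurable U -> rho (U `*` setT) = nu U.

Lemma preimage_fst_setX (U : set X) : fst @^-1` U = U `*` [set: R].
Proof. by apply/seteqP; split=> [z|z []]. Qed.

Lemma ge0_integral_marginal (f : X -> \bar R) :
  measurable_fun setT f -> (forall x, 0 <= f x)%E ->
  (\int[rho]_z f z.1 = \int[nu]_x f x)%E.
Proof.
move=> mf f0.
transitivity (\int[pushforward rho (@fst X R)]_x f x)%E.
  by rewrite ge0_integral_pushforward.
apply: eq_measure_integral => U mU _.
by have := hnu mU; rewrite -preimage_fst_setX; exact.
Qed.

(** Integrability of h is not part of the definition: it follows from the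
    finiteness of the integrals of h over the sets where h >= 0 and h < 0. *)
Lemma conditional_expectation_integrable Z h :
  conditional_expectation rho nu Z h -> nu.-integrable setT (EFin \o h).
Proof.
move=> [iZ mh hU]; have mEh : measurable_fun setT (EFin \o h) by exact/measurable_EFinP.
pose U := [set x | 0 <= h x].
have mU : measurable U.
  rewrite (_ : U = h @^-1` `[0, +oo[); first by rewrite -[X in measurable X]setTI; exact: mh.
  by apply/seteqP; split=> x; rewrite /U/= in_itv/= andbT.
have fin V : measurable V -> (\int[nu]_(x in V) (h x)%:E)%E \is a fin_num.
  move=> mV; rewrite -hU//; apply: integrable_fin_num; first exact: measurableX.
  by apply: integrableS iZ => //; exact: measurableX.
apply/integrableP; split => //.
rewrite -(setUv U) ge0_integral_setU//; last 3 first.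
- exact: measurableC.
- by rewrite setUv; apply: measurableT_comp.
- by rewrite disj_set2E setICr.
rewrite lte_add_pinfty//.
  rewrite (eq_integral (fun x => (h x)%:E)) => [|x]; first by rewrite ltey_eq fin.
  by rewrite inE => /= Ux; rewrite ger0_norm.
have := fin _ (measurableC mU).
rewrite (_ : (\int[nu]_(x in ~` U) (h x)%:E =
  \int[nu]_(x in ~` U) - `|(EFin \o h) x|)%E); last first.
  apply: eq_integral => x; rewrite inE => /= Ux; rewrite ler0_norm ?opprK//.
  by rewrite leNgt; apply/negP => x0; apply: Ux; exact: ltW.
by rewrite integral_ge0N// fin_numN => H; rewrite ltey_eq H.
Qed.

Lemma conditional_expectation_unique Z h h' :
  conditional_expectation rho nu Z h -> conditional_expectation rho nu Z h' ->
  h = h' %[ae nu].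
Proof.
move=> Zh Zh'.
have : ae_eq nu setT (EFin \o h) (EFin \o h').
  apply: integral_ae_eq => //; first exact: conditional_expectation_integrable Zh.
    by apply/measurable_EFinP; case: Zh'.
  by move=> E _ mE; case: Zh => _ _ <- //; case: Zh' => _ _ <-.
by apply: filterS => x /= /(_ I) [hx] _.
Qed.

Lemma conditional_expectation_mul Z h (g : X -> R) (C : R) :
  conditional_expectation rho nu Z h -> measurable_fun setT g ->
  (forall x, `|g x| <= C) ->
  (\int[rho]_z (Z z * g z.1)%:E = \int[nu]_x (h x * g x)%:E)%E.
Proof.
move=> Zh mg gC; have [iZ mh hU] := Zh.
apply: (integral_bounded_multiplier (p := @fst X R) _ iZ _ _ mg gC) => //.
  exact: conditional_expectation_integrable Zh.
by move=> U mU; rewrite preimage_fst_setX hU.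
Qed.

(** Split Y = (Y - m(X)) + m(X) with m a version of E(Y | X), so m = y almost
    everywhere: the first part contributes the conditional variance, the second
    the bound on y.  The factor 2 comes from (u + v)^2 <= 2 u^2 + 2 v^2. *)
Lemma second_moment_le (y g : X -> R) (sigma B C : R) :
  conditional_expectation rho nu snd y ->
  conditional_variance rho nu snd (cst (sigma ^+ 2)) ->
  {ae nu, forall x, `|y x| <= B} ->
  measurable_fun setT g -> (forall x, `|g x| <= C) ->
  (\int[rho]_z ((z.2 * g z.1) ^+ 2)%:E <=
   (2 * (sigma ^+ 2 + B ^+ 2))%:E * \int[nu]_x (g x ^+ 2)%:E)%E.
Proof.
move=> hy [m hm hv] yB mg gC.
have my : {ae nu, forall x, m x = y x}.
  by have := conditional_expectation_unique hm hy; apply: filterS => x; exact.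
have [_ mm _] := hm.
have nn (a b : R) : 0 <= 2 * (a ^+ 2 * b ^+ 2).
  by apply: mulr_ge0 => //; apply: mulr_ge0; exact: sqr_ge0.
have mmg : measurable_fun setT (fun x => 2 * (m x ^+ 2 * g x ^+ 2)).
  by apply: measurable_funM => //; apply: measurable_funM; exact: measurable_funX.
have mV : measurable_fun [set: X * R] (fun z => 2 * ((z.2 - m z.1) ^+ 2 * g z.1 ^+ 2)).
  apply: measurable_funM => //; apply: measurable_funM; apply: measurable_funX.
    by apply: measurable_funB => //; exact: measurableT_comp.
  exact: measurableT_comp.
have mW : measurable_fun [set: X * R] (fun z => 2 * (m z.1 ^+ 2 * g z.1 ^+ 2)).
  exact: (measurableT_comp mmg).
apply: (@le_trans _ _ (\int[rho]_z ((2 * ((z.2 - m z.1) ^+ 2 * g z.1 ^+ 2))%:E +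
   (2 * (m z.1 ^+ 2 * g z.1 ^+ 2))%:E))%E).
  apply: ge0_le_integral => //.
  - by move=> z _; rewrite lee_fin sqr_ge0.
  - apply/measurable_EFinP/measurable_funX; apply: measurable_funM => //.
    exact: measurableT_comp.
  - by apply: emeasurable_funD; exact/measurable_EFinP.
  - move=> z _; rewrite -EFinD lee_fin -subr_ge0.
    rewrite (_ : _ - _ = ((z.2 - m z.1 - m z.1) * g z.1) ^+ 2); last by ring.
    exact: sqr_ge0.
rewrite ge0_integralD//; last 4 first.
- by move=> z _; rewrite lee_fin; exact: nn.
- exact/measurable_EFinP.
- by move=> z _; rewrite lee_fin; exact: nn.
- exact/measurable_EFinP.
have i2 : (0 <= \int[nu]_x (g x ^+ 2)%:E)%E.
  by apply: integral_ge0 => x _; rewrite lee_fin sqr_ge0.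
have B2 : 0 <= 2 * B ^+ 2 by apply: mulr_ge0 => //; exact: sqr_ge0.
have S2 : 0 <= 2 * sigma ^+ 2 by apply: mulr_ge0 => //; exact: sqr_ge0.
rewrite mulrDr EFinD ge0_muleDl ?lee_fin//.
apply: leeD.
  under eq_integral do rewrite EFinM.
  rewrite ge0_integralZl_EFin//; last 2 first.
  - by move=> z _; rewrite lee_fin mulr_ge0// sqr_ge0.
  - apply/measurable_EFinP; apply: measurable_funM; apply: measurable_funX.
      by apply: measurable_funB => //; exact: measurableT_comp.
    exact: measurableT_comp.
  rewrite (conditional_expectation_mul (g := fun x => g x ^+ 2) (C := C ^+ 2) hv)//; last 2 first.
  - exact: measurable_funX.
  - move=> x; rewrite ger0_norm ?sqr_ge0// -(real_normK (num_real (g x))).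
    by rewrite ler_sqr ?nnegrE ?normr_ge0// (le_trans (normr_ge0 (g x)) (gC x)).
  rewrite EFinM -muleA; apply: lee_wpmul2l => //.
  under eq_integral do rewrite EFinM.
  rewrite ge0_integralZl_EFin ?sqr_ge0//.
  - by move=> x _; rewrite lee_fin sqr_ge0.
  - by apply/measurable_EFinP; exact: measurable_funX.
rewrite (@ge0_integral_marginal (fun x => (2 * (m x ^+ 2 * g x ^+ 2))%:E)); last 2 first.
- exact/measurable_EFinP.
- by move=> z; rewrite lee_fin; exact: nn.
rewrite -ge0_integralZl_EFin//; last 2 first.
- by move=> x _; rewrite lee_fin sqr_ge0.
- by apply/measurable_EFinP; exact: measurable_funX.
apply: ae_ge0_le_integral => //.
- by move=> z _; rewrite lee_fin; exact: nn.
- exact/measurable_EFinP.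
- by move=> z _; rewrite -EFinM lee_fin; apply: mulr_ge0 => //; exact: sqr_ge0.
- by apply: measurable_funeM; apply/measurable_EFinP; exact: measurable_funX.
apply: filterS2 my yB => x -> yB _; rewrite -EFinM lee_fin mulrA.
apply: ler_wpM2r; first exact: sqr_ge0.
apply: ler_wpM2l => //; rewrite -(real_normK (num_real (y x))).
by rewrite ler_sqr ?nnegrE ?normr_ge0// (le_trans (normr_ge0 (y x)) yB).
Qed.

End conditional_moments.

(** * Effective dimension *)

Section effective_dimension.
Context (R : realType).
Implicit Types (b lam : R).

Lemma powR_gt0D (x a c : R) : 0 < x -> x `^ (a + c) = x `^ a * x `^ c.
Proof. by move=> x0; rewrite powRD// (gt_eqF x0) implybT. Qed.

(** Comparison of the sum with an integral, without the integral: with c = b - 1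
    the claim reads 1 + c / (j + 1) <= ((j + 1) / j)^c, which follows from
    1 + u <= exp u used at u = - 1 / (j + 1) and at u = c / (j + 1). *)
Lemma powR_tail_term b (j : nat) : 1 < b -> (0 < j)%N ->
  (b - 1) / (j.+1%:R `^ b) <= j%:R `^ (1 - b) - j.+1%:R `^ (1 - b) :> R.
Proof.
move=> b1 j0; set y : R := j.+1%:R; set x : R := j%:R.
have x0 : 0 < x by rewrite ltr0n.
have y0 : 0 < y by rewrite ltr0n.
have yE : y = x + 1 by rewrite /y -natr1.
pose c := b - 1; have c0 : 0 < c by rewrite subr_gt0.
have cE : 1 - b = - c by rewrite opprB.
have ex : expR y^-1 <= y / x.
  have := expR_ge1Dx (- y^-1); rewrite expRN.
  rewrite (_ : 1 + - y^-1 = x / y); last by rewrite yE; field; rewrite -yE gt_eqF.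
  move=> h; rewrite -(invf_div x y) -[leLHS]invrK lef_pV2 ?posrE ?divr_gt0//.
  by rewrite invr_gt0 expR_gt0.
have h1 : 1 + c / y <= (y / x) `^ c.
  apply: (@le_trans _ _ (expR y^-1 `^ c)); last first.
    by rewrite ge0_ler_powR ?nnegrE ?expR_ge0 ?divr_ge0 ?(ltW c0) ?(ltW x0) ?(ltW y0).
  by rewrite -expRM mulrC; exact: expR_ge1Dx.
rewrite cE; have -> : x `^ (- c) = y `^ (- c) * (y / x) `^ c.
  rewrite powRM ?invr_ge0 ?(ltW x0) ?(ltW y0)// mulrA -powR_gt0D//.
  by rewrite addNr powRr0 mul1r -(powR_inv1 (ltW x0)) -powRrM mulN1r.
have -> : (b - 1) / y `^ b = y `^ (- c) * (c / y).
  rewrite -/c (_ : b = c + 1); last by rewrite subrK.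
  rewrite powR_gt0D// powRr1 ?(ltW y0)// powRN invfM.
  by rewrite mulrCA.
rewrite [leRHS](_ : _ = y `^ (- c) * ((y / x) `^ c - 1)); last by rewrite mulrBr mulr1.
by rewrite ler_wpM2l ?powR_ge0// lerBrDl.
Qed.

Lemma powR_tail_sum b (J N : nat) : 1 < b -> (0 < J)%N ->
  \sum_(J <= j < J + N) (j.+1%:R `^ b)^-1 <= J%:R `^ (1 - b) / (b - 1) :> R.
Proof.
move=> b1 J0; rewrite ler_pdivlMr ?subr_gt0// mulr_suml.
apply: (@le_trans _ _ (J%:R `^ (1 - b) - (J + N)%:R `^ (1 - b))); last first.
  by rewrite gerBl powR_ge0.
elim: N => [|N IH]; first by rewrite addn0 big_geq// subrr.
rewrite addnS big_nat_recr ?leq_addr//= mulrC.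
have := powR_tail_term b1 (ltn_addr N J0).
by move: IH; set S := \sum_(_ <= _ < _) _; lra.
Qed.

(** The terms are bounded by C1 / lam for the about lam^(-1/b) large eigenvalues
    and by C2 / lam^2 times dd / (j+1)^b beyond; both parts are of order
    lam^(-1-1/b).  The bound lam <= L absorbs the rounding of lam^(-1/b) to an
    integer. *)
Lemma effective_dimension_sum (b dd C1 C2 L : R) : 1 < b -> 0 < dd -> 0 <= C1 -> 0 <= C2 -> 0 < L ->
  exists2 C, 0 <= C & forall lam (v : nat -> R) N, 0 < lam -> lam <= L ->
   (forall j, v j <= C1 / lam) ->
   (forall j, v j <= C2 / lam ^+ 2 * (dd / (j.+1%:R `^ b))) ->
   (forall j, 0 <= v j) ->
   \sum_(0 <= j < N) v j <= C * lam `^ (- (1 + 1 / b)).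
Proof.
move=> b1 d0 C10 C20 L0; have b0 : 0 < b by lra.
exists (C1 * (1 + L `^ (1 / b)) + C2 * dd / (b - 1)).
  apply: addr_ge0; first by rewrite mulr_ge0// addr_ge0// powR_ge0.
  by rewrite divr_ge0 ?mulr_ge0 ?(ltW d0)// subr_ge0 ltW.
move=> lam v N lam0 lamL v1 v2 v0.
pose rho := lam `^ (- (1 / b)).
have rho0 : 0 < rho by rewrite powR_gt0.
have -> : lam `^ (- (1 + 1 / b)) = lam^-1 * rho.
  by rewrite opprD powR_gt0D// powR_inv1 ?ltW.
have rhob : rho `^ (1 - b) = rho * lam.
  rewrite -powRrM (_ : - (1 / b) * (1 - b) = - (1 / b) + 1); last by field; rewrite gt_eqF.
  by rewrite powR_gt0D// powRr1 ?ltW.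
pose J := (Num.truncn rho).+1.
have /andP[_ rhoJ] := truncn_itv (ltW rho0).
have Jrho : J%:R <= rho * (1 + L `^ (1 / b)).
  rewrite mulrDr mulr1 -natr1 lerD//; first by rewrite truncn_le ltW.
  rewrite /rho powRN mulrC ler_pdivlMr ?powR_gt0// !mul1r.
  by rewrite ge0_ler_powR ?nnegrE ?invr_ge0 ?(ltW b0) ?(ltW lam0) ?(ltW L0).
have -> : (C1 * (1 + L `^ (1 / b)) + C2 * dd / (b - 1)) * (lam^-1 * rho) =
   rho * (1 + L `^ (1 / b)) * (C1 / lam) + C2 / lam ^+ 2 * dd * (rho * lam / (b - 1)).
  have bN : b - 1 != 0 by rewrite gt_eqF// subr_gt0.
  have lamN : lam != 0 by rewrite gt_eqF.
  by field; rewrite ?bN ?lamN.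
apply: (@le_trans _ _ (\sum_(0 <= j < J + N) v j)).
  by rewrite addnC [leRHS](big_cat_nat _ (n := N)) ?leq_addr//= lerDl sumr_ge0.
rewrite (big_cat_nat _ (n := J)) ?leq_addr//=; apply: lerD.
  apply: (@le_trans _ _ (\sum_(0 <= j < J) C1 / lam)); first by apply: ler_sum.
  rewrite big_const_nat subn0 iter_addr_0 -mulr_natl ler_wpM2r// divr_ge0// ltW//.
apply: (@le_trans _ _ (\sum_(J <= j < J + N) C2 / lam ^+ 2 * dd * (j.+1%:R `^ b)^-1)).
  by apply: ler_sum => j _; rewrite -mulrA.
rewrite -mulr_sumr ler_wpM2l//.
  by rewrite mulr_ge0 ?(ltW d0)// divr_ge0// sqr_ge0.
apply: le_trans (powR_tail_sum N b1 (ltn0Sn _)) _.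
rewrite ler_wpM2r ?invr_ge0 ?subr_ge0 ?(ltW b1)// -rhob.
rewrite -(opprB b 1) !powRN lef_pV2 ?posrE ?powR_gt0//.
by rewrite ge0_ler_powR ?nnegrE ?subr_ge0 ?(ltW b1) ?(ltW rho0)// ltW.
Qed.

End effective_dimension.

(** * The squared error as a series *)

(** The squared error is not known to be a measurable function of the sample. The
    integral of a nonnegative function is a supremum over the simple functions
    below it, which is monotone without measurability. *)
Lemma ge0_le_integral_nonmeasurable (d : measure_display) (T : measurableType d)
  (R : realType) (m : {measure set T -> \bar R}) (f g : T -> \bar R) :
  (forall t, 0 <= f t)%E -> (forall t, f t <= g t)%E ->
  (\int[m]_t f t <= \int[m]_t g t)%E.
Proof.
move=> f0 fg; rewrite !ge0_integralTE//; last by move=> t; exact: le_trans (fg t).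
apply: le_ereal_sup => _ [h /= hf <-]; exists h => // t.
exact: le_trans (hf t) (fg t).
Qed.

Section series_estimator.
Context (d1 d2 : measure_display) (T : measurableType d1)
  (X : measurableType d2) (R : realType).
Variables (mu : {measure set T -> \bar R}) (nu : {measure set X -> \bar R}).
Variables (phi : X -> L2 mu) (A : L2 mu -> L2 nu).
Hypothesis phi_A : forall f x, A f x = L2dot f (phi x).
Variables (mu_ : nat -> R) (e : nat -> L2 mu).
Hypothesis e_ortho : forall i j, 0 < mu_ i -> 0 < mu_ j ->
  L2dot (e i) (e j) = (i == j)%:R.

(** v lies in the closed span of the eigenvectors, that is, in the orthogonal of
    the kernel of B; there the value of h at 0 has no effect on h(B) v. *)
Definition spanned (v : L2 mu) := (fun n => L2norm (v -
  \sum_(0 <= j < n | 0 < mu_ j) L2dot v (e j) *: e j)) @ \oo --> 0.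

Lemma spanned0 : spanned 0.
Proof.
rewrite /spanned; under eq_fun do (under eq_bigr do rewrite L2dot0l scale0r).
under eq_fun do rewrite big1// subrr L2norm0.
exact: cvg_cst.
Qed.

Lemma spannedD v w : spanned v -> spanned w -> spanned (v + w).
Proof.
move=> sv sw; have svw := cvgD sv sw; rewrite addr0 in svw.
apply: squeeze_cvgr; [|exact: cvg_cst|exact: svw]; apply: nearW => n.
rewrite L2norm_ge0/=; apply: le_trans (ler_L2normD _ _).
rewrite addrACA -opprD -big_split/= le_eqVlt; apply/orP; left; apply/eqP.
by congr (L2norm (_ - _)); apply: eq_bigr => j _; rewrite L2dotDl scalerDl.
Qed.

Lemma spannedZ k v : spanned v -> spanned (k *: v).
Proof.
move=> sv; rewrite /spanned (_ : (fun n => _) = (fun n => `|k| *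
    L2norm (v - \sum_(0 <= j < n | 0 < mu_ j) L2dot v (e j) *: e j))).
  exact: cvgMl0.
apply/funext => n; rewrite -L2normZ scalerBr scaler_sumr; congr (L2norm (_ - _)).
by apply: eq_bigr => j _; rewrite L2dotZl scalerA.
Qed.

Lemma spanned_empirical_adjoint n (z : n.-tuple (X * R)) :
  (forall i, spanned (phi (tnth z i).1)) -> spanned (empirical_adjoint phi z).
Proof.
move=> sz; apply: spannedZ; elim/big_ind : _ => [||i _]; first exact: spanned0.
  by move=> v w; exact: spannedD.
by apply: spannedZ; exact: sz.
Qed.

Lemma L2dot_empirical_adjoint n (z : n.-tuple (X * R)) j :
  L2dot (empirical_adjoint phi z) (e j) =
  n%:R^-1 * \sum_(i < n) (tnth z i).2 * A (e j) (tnth z i).1.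
Proof.
rewrite /empirical_adjoint L2dotZl L2dot_suml; congr (_ * _).
by apply: eq_bigr => i _; rewrite L2dotZl phi_A L2dotC.
Qed.

Lemma spectral_fun_spanned_cvg h v (C : R) : (forall j, 0 < mu_ j -> `|h (mu_ j)| <= C) ->
  h 0 = 0 \/ spanned v ->
  (fun n => L2norm (\sum_(0 <= j < n | 0 < mu_ j) (h (mu_ j) * L2dot v (e j)) *: e j -
     spectral_fun mu_ e h v)) @ \oo --> 0.
Proof.
move=> hC hv; have Hs := spectral_fun_cvg e_ortho v hC.
have Hr : (fun n => L2norm (h 0 *:
    (v - \sum_(0 <= j < n | 0 < mu_ j) L2dot v (e j) *: e j))) @ \oo --> 0.
  case: hv => [->|sv]; first by under eq_fun do rewrite scale0r L2norm0; exact: cvg_cst.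
  under eq_fun do rewrite L2normZ.
  exact: cvgMl0.
have H := cvgD Hs Hr; rewrite addr0 in H.
apply: squeeze_cvgr; [|exact: cvg_cst|exact: H]; apply: nearW => n.
rewrite L2norm_ge0.
pose c := h 0 *: (v - \sum_(0 <= j < n | 0 < mu_ j) L2dot v (e j) *: e j).
rewrite -[leRHS]/(L2norm (spectral_sum mu_ e h v n - spectral_fun mu_ e h v) + L2norm c).
rewrite -(L2normN c); apply: le_trans (ler_L2normD _ _).
by rewrite spectral_sumE -/c addrAC addrK.
Qed.

(** Parseval's identity for h(B) v - fdag, given the coefficients f of fdag. *)
Lemma sqr_dist_spectral_fun h v fdag f (C : R) : (forall j, 0 < mu_ j -> `|h (mu_ j)| <= C) ->
  h 0 = 0 \/ spanned v ->
  (fun n => L2norm (\sum_(0 <= j < n | 0 < mu_ j) f j *: e j - fdag)) @ \oo --> 0 ->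
  ((L2norm (spectral_fun mu_ e h v - fdag) ^+ 2)%:E =
   \sum_(0 <= j <oo | (0 < mu_ j)%R) ((h (mu_ j) * L2dot v (e j) - f j) ^+ 2)%:E)%E.
Proof.
move=> hC hv ff; have H := spectral_fun_spanned_cvg hC hv.
have := L2cvgD H (L2cvgZ (-1) ff); rewrite scaleN1r => /L2norm_cvg K.
have K2 := cvgM K K.
apply/esym/(cvg_lim (@ereal_hausdorff _)).
rewrite (_ : (fun n => _) = (fun n =>
        (L2norm (\sum_(0 <= j < n | 0 < mu_ j) (h (mu_ j) * L2dot v (e j)) *: e j +
        -1 *: \sum_(0 <= j < n | 0 < mu_ j) f j *: e j) ^+ 2)%:E)); last first.
  apply/funext => n; rewrite sumEFin; congr (_%:E).
  rewrite scaleN1r -sumrB -(L2norm_orthosum e_ortho).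
  by congr (L2norm _ ^+ 2); apply: eq_bigr => j _; rewrite scalerBl.
apply: cvg_EFin; first exact: nearW.
exact: K2.
Qed.

End series_estimator.

(** * Bias and variance *)

(** Bias plus variance for the multiple s of an empirical mean of W, as an estimator
    of f; the variance of W is bounded by its second moment V. *)
Lemma expectation_sqr_mean_le (d : measure_display) (T : measurableType d)
  (R : realType) (rho : probability T R) (W : T -> R) (m V s f : R) (n : nat) :
  (0 < n)%N -> rho.-integrable setT (EFin \o W) ->
  (\int[rho]_z (W z)%:E = m%:E)%E -> (\int[rho]_z ((W z) ^+ 2)%:E <= V%:E)%E ->
  (\int[product_power rho n]_z
     ((s * (n%:R^-1 * \sum_(i < n) W (tnth z i)) - f) ^+ 2)%:E <=
   ((s * m - f) ^+ 2 + s ^+ 2 * V / n%:R)%:E)%E.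
Proof.
move=> n0 iW Wm WV.
have nN : n%:R != 0 :> R by rewrite pnatr_eq0 -lt0n.
have mW : measurable_fun setT W by apply/measurable_EFinP; exact: measurable_int iW.
have mW2 : measurable_fun setT (fun z => W z ^+ 2) by exact: measurable_funX.
have iW2 : rho.-integrable setT (fun z => (W z ^+ 2)%:E).
  apply/integrableP; split; first exact/measurable_EFinP.
  rewrite (eq_integral (fun z => (W z ^+ 2)%:E)); last first.
    by move=> z _; rewrite gee0_abs// lee_fin sqr_ge0.
  by apply: le_lt_trans WV _; rewrite ltry.
pose w2 := fine (\int[rho]_z (W z ^+ 2)%:E)%E.
have w2E : (\int[rho]_z (W z ^+ 2)%:E)%E = w2%:E.
  by rewrite fineK//; exact: integrable_fin_num.
have w2V : w2 <= V by rewrite -lee_fin -w2E.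
pose a := s / n%:R.
pose xi z := a * (W z - m).
pose v := a ^+ 2 * (w2 - m ^+ 2).
have xiE b : (\int[rho]_z ((b + xi z) ^+ 2)%:E = (b ^+ 2 + v)%:E)%E.
  pose k := b - a * m.
  transitivity (\int[rho]_z ((a ^+ 2)%:E * (W z ^+ 2)%:E +
      ((2 * a * k)%:E * (W z)%:E + (k ^+ 2)%:E)))%E.
    by apply: eq_integral => z _; rewrite -!EFinM -!EFinD; congr (_%:E); rewrite /xi /k; ring.
  have i1 : rho.-integrable setT (fun z => (a ^+ 2)%:E * (W z ^+ 2)%:E)%E by exact: integrableZl.
  have i2 : rho.-integrable setT (fun z => (2 * a * k)%:E * (W z)%:E)%E by exact: integrableZl.
  have i3 : rho.-integrable setT (fun z : T => (k ^+ 2)%:E).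
    by apply: finite_measure_integrable_cst.
  rewrite integralD//; last exact: integrableD.
  rewrite integralD// !integralZl// w2E Wm integral_probability_cst.
  by rewrite -!EFinM -!EFinD; congr (_%:E); rewrite /v /k; ring.
have v0 : 0 <= v.
  have := xiE 0; rewrite expr0n/= add0r => E; rewrite -lee_fin -E.
  by apply: integral_ge0 => z _; rewrite lee_fin sqr_ge0.
have mxi : measurable_fun setT xi by apply: measurable_funM => //; exact: measurable_funB.
have := integral_sqr_sum_tnth mxi v0 xiE n (s * m - f).
rewrite (eq_integral (fun z => ((s * (n%:R^-1 * \sum_(i < n) W (tnth z i)) - f) ^+ 2)%:E)).
  move=> ->; rewrite lee_fin lerD2l /v /a.
  rewrite (_ : n%:R * _ = s ^+ 2 * (w2 - m ^+ 2) / n%:R); last by field.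
  rewrite ler_wpM2r ?invr_ge0// ler_wpM2l ?sqr_ge0//.
  by apply: le_trans w2V; rewrite gerBl sqr_ge0.
move=> z _; congr ((_ ^+ 2)%:E); rewrite /xi -mulr_sumr sumrB sumr_const card_ord.
by rewrite /a -mulr_natl; field.
Qed.

Section risk_bound.
Context (R : realType)
  (d1 d2 : measure_display) (T : measurableType d1) (X : measurableType d2)
  (mu : {sigma_finite_measure set T -> \bar R}) (nu : probability X R)
  (phi : X -> L2 mu) (A : {linear L2 mu -> L2 nu})
  (hA : kernel_operator phi A)
  (Astar : L2 nu -> L2 mu) (hAstar : is_adjoint A Astar)
  (mu_ : nat -> R) (e : nat -> L2 mu)
  (he : eigensystem (Astar \o A) mu_ e)
  (s : R -> R -> R) (q : R)
  (hs : regularization (spectrum (Astar \o A)) s q)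
  (rho : probability (X * R)%type R)
  (hnu : forall U : set X, measurable U -> rho (U `*` setT) = nu U)
  (y : L2 nu) (fdag : L2 mu)
  (hyA : A fdag = y %[ae nu])
  (hmean : conditional_expectation rho nu snd y)
  (sigma : R)
  (hvar : conditional_variance rho nu snd (cst (sigma ^+ 2)))
  (r rad : R) (r0 : 0 < r) (rq : r <= q)
  (hsource : source_set mu_ e r rad fdag)
  (dd b : R) (d0 : 0 < dd) (b1 : 1 < b)
  (hdecay : forall j : nat, mu_ j <= dd / (j.+1%:R `^ b)).

Let e_ortho := eigenvector_ortho he.
Let f_ j := L2dot fdag (e j).

Lemma eigenvalue_le j : mu_ j <= dd.
Proof.
apply: le_trans (hdecay j) _; rewrite ler_pdivrMr ?powR_gt0//.
rewrite ler_peMr ?(ltW d0)// [leLHS](_ : 1 = 1 `^ b); last by rewrite powR1.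
by rewrite ge0_ler_powR ?nnegrE// ?ler1n// (le_trans ler01)// ltW.
Qed.

(** Here 0 ^ r = 0 because r > 0, so the part of w in the kernel of B does not
    contribute to fdag. *)
Lemma source_coefficients : exists w : L2 mu, [/\ L2norm w <= rad,
  forall j, 0 < mu_ j -> f_ j = mu_ j `^ r * L2dot w (e j) &
  (fun n => L2norm (\sum_(0 <= j < n | 0 < mu_ j) f_ j *: e j - fdag)) @ \oo --> 0].
Proof.
have [w wrad fw] := hsource; exists w.
have hC j : 0 < mu_ j -> `|mu_ j `^ r| <= dd `^ r.
  move=> Pj; rewrite ger0_norm ?powR_ge0// ge0_ler_powR ?nnegrE ?(ltW r0) ?(ltW d0) ?(ltW Pj)//.
  exact: eigenvalue_le.
have h0 : (fun t : R => t `^ r) 0 = 0 \/ spanned mu_ e w.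
  by left; rewrite powR0// gt_eqF.
have H0 := spectral_fun_spanned_cvg (h := fun t => t `^ r) e_ortho hC h0.
have fw0 := L2norm_ae_eq fw.
have H : (fun n => L2norm (\sum_(0 <= j < n | 0 < mu_ j)
    (mu_ j `^ r * L2dot w (e j)) *: e j - fdag)) @ \oo --> 0.
  apply: squeeze_cvgr; [|exact: cvg_cst|exact: H0]; apply: nearW => n.
  rewrite L2norm_ge0/=.
  apply: le_trans (ler_L2normB _ (spectral_fun mu_ e (fun t => t `^ r) w) _) _.
  by rewrite (L2normB _ fdag) fw0 addr0.
have fE j : 0 < mu_ j -> f_ j = mu_ j `^ r * L2dot w (e j).
  move=> Pj; have /(cvg_lim (@norm_hausdorff _ _)) := L2dot_cvg (g := e j) H.
  rewrite /f_ => <-; apply: (cvg_lim (@norm_hausdorff _ _)); apply: cvg_near_cst.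
  exists j.+1 => // n /= jn.
  exact: (L2dot_orthosum e_ortho (fun j => mu_ j `^ r * L2dot w (e j)) Pj).
split=> //; rewrite (_ : (fun n => _) = (fun n => L2norm (\sum_(0 <= j < n | 0 < mu_ j)
   (mu_ j `^ r * L2dot w (e j)) *: e j - fdag)))//.
by apply/funext => n; congr (L2norm (_ - _)); apply: eq_bigr => j Pj; rewrite fE.
Qed.

(** W z = Y (A e_j)(X) is a single observation of the j-th coefficient of the
    empirical adjoint.  Its mean is the inner product of A fdag and A e_j, and
    its second moment carries the factor mu_j, the squared norm of A e_j. *)
Lemma noise_moments : exists2 V, 0 <= V & forall j, 0 < mu_ j ->
  let W := fun z : X * R => z.2 * A (e j) z.1 in
  [/\ rho.-integrable setT (EFin \o W),
      (\int[rho]_z (W z)%:E = (mu_ j * f_ j)%:E)%E &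
      (\int[rho]_z (W z ^+ 2)%:E <= (V * mu_ j)%:E)%E].
Proof.
have [c c0 cP] := operator_pointwise hA.
exists (2 * (sigma ^+ 2 + (c * L2norm fdag) ^+ 2)).
  by apply: mulr_ge0 => //; apply: addr_ge0; exact: sqr_ge0.
move=> j Pj W.
have gC x : `|A (e j) x| <= c * L2norm (e j) by exact: cP.
split.
- have [iY _ _] := hmean.
  apply: (integrable_bounded_mul (C := c * L2norm (e j)) iY) => //.
  exact: measurableT_comp.
- rewrite (conditional_expectation_mul hmean _ gC)// -L2dotE.
  congr (_%:E); rewrite -(L2dot_image_eigenvector hAstar he)//.
  exact/esym/L2dot_eq_dist/L2norm_ae_eq.
- rewrite (le_trans (second_moment_le (B := c * L2norm fdag) hnu hmean hvar _ _ gC))//.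
    by apply: filterS hyA => x /(_ I) <-; exact: cP.
  rewrite -L2norm_sqrE L2norm_sqr (image_eigenvector_ortho hAstar he)// eqxx mulr1.
  by rewrite -EFinM.
Qed.

(** The two bounds on s^2 mu_j combine |lam s| <= E with |mu_j s| <= D and with
    itself; they are the two regimes of the effective dimension.  The last
    bound is the qualification at the exponent r. *)
Lemma filter_bounds : exists C D E, [/\ 0 < C, 0 < D, 0 < E &
  forall lam j, 0 < lam -> 0 < mu_ j ->
  [/\ `|s lam (mu_ j)| <= E / lam, (s lam (mu_ j)) ^+ 2 * mu_ j <= E * D / lam,
     (s lam (mu_ j)) ^+ 2 * mu_ j <= E ^+ 2 / lam ^+ 2 * (dd / j.+1%:R `^ b) &
     (mu_ j `^ r * (1 - mu_ j * s lam (mu_ j))) ^+ 2 <= C ^+ 2 * lam `^ (2 * r)]].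
Proof.
have [D D0 hD] := regularization_ts hs.
have [E E0 hE] := regularization_lams hs.
have [C C0 hC] := qualification hs.
have rr : 0 <= r <= q by rewrite (ltW r0).
exists (C r), D, E; split=> // [|lam j lam0 j0]; first exact: C0.
have sp := eigenvalue_in_spectrum he j0.
have sE : `|s lam (mu_ j)| <= E / lam.
  by rewrite ler_pdivlMr// mulrC; have := hE _ _ lam0 sp; rewrite normrM gtr0_norm.
have E2 : s lam (mu_ j) ^+ 2 <= E ^+ 2 / lam ^+ 2.
  rewrite -expr_div_n -(real_normK (num_real (s lam _))).
  by rewrite ler_sqr ?nnegrE ?normr_ge0// divr_ge0// ltW.
split=> //.
- have sD : `|s lam (mu_ j)| * mu_ j <= D.
    by rewrite mulrC; have := hD _ _ lam0 sp; rewrite normrM gtr0_norm.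
  rewrite -(real_normK (num_real (s lam _))) expr2.
  rewrite [leRHS](_ : _ = E / lam * D); last by rewrite /= mulrAC.
  rewrite [leLHS](_ : _ = `|s lam (mu_ j)| * (`|s lam (mu_ j)| * mu_ j)); last by rewrite mulrA.
  by apply: ler_pM => //; rewrite mulr_ge0// ltW.
- by apply: ler_pM => //; [exact: sqr_ge0|exact: ltW].
- have := hC r _ _ rr lam0 sp; set x := _ * (1 - _) => xC.
  rewrite mulrC (mulrC 2) powRrM powR_mulrn ?powR_ge0// -exprMn mulrC.
  rewrite -(real_normK (num_real x)) ler_sqr ?nnegrE ?normr_ge0//.
  by apply: le_trans xC; exact: normr_ge0.
Qed.

(** Outside a null set of samples the squared error is the series of the squared
    errors of the coefficients, whose expectations are summed term by term. *)
Lemma risk_le (L : R) : 0 < L -> exists2 K, 0 <= K & forall n lam,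
  (0 < n)%N -> 0 < lam -> lam <= L ->
  (risk rho fdag (estimator phi mu_ e s lam (n := n)) <=
   (K * (lam `^ (2 * r) + lam `^ (- (1 + 1 / b)) / n%:R))%:E)%E.
Proof.
move=> L0.
have [w [wrad fE fcvg]] := source_coefficients.
have [V V0 hV] := noise_moments.
have [C [D [E [C0 D0 E0 hs']]]] := filter_bounds.
have ED0 : 0 <= E * D by rewrite mulr_ge0// ltW.
have [Ce Ce0 hCe] := effective_dimension_sum b1 d0 ED0 (sqr_ge0 E) L0.
exists (C ^+ 2 * rad ^+ 2 + V * Ce).
  by apply: addr_ge0; [apply: mulr_ge0; exact: sqr_ge0|exact: mulr_ge0].
move=> n lam n0 lam0 lamL.
pose W j (z : X * R) := z.2 * A (e j) z.1.
pose term j (z : n.-tuple (X * R)) : \bar R := if 0 < mu_ j then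
  ((s lam (mu_ j) * (n%:R^-1 * \sum_(i < n) W j (tnth z i)) - f_ j) ^+ 2)%:E else 0%E.
pose bound j : R := if 0 < mu_ j then
  (s lam (mu_ j) * (mu_ j * f_ j) - f_ j) ^+ 2 + s lam (mu_ j) ^+ 2 * (V * mu_ j) / n%:R else 0.
have [N0 [mN0 N00 subN0]] := kernel_expansion hA hAstar he.
(* H is +oo on the null set where the kernel expansion fails; the sum of its
   values over the sample has integral 0 and dominates the squared error there. *)
pose H (z : X * R) : \bar R := (+oo * (\1_N0 z.1)%:E)%E.
have term0 j z : (0 <= term j z)%E.
  by rewrite /term; case: ifP => _; rewrite ?lee_fin ?sqr_ge0.
have H0 z : (0 <= H z)%E by rewrite mule_ge0// lee_fin indicE; case: (_ \in _).
have mW j : measurable_fun setT (W j).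
  by apply: measurable_funM => //; exact: measurableT_comp.
have mterm j : measurable_fun setT (term j).
  rewrite /term; case: (0 < mu_ j); last exact: measurable_cst.
  apply/measurable_EFinP/measurable_funX; apply: measurable_funB => //.
  do 2 apply: measurable_funM => //; exact: measurable_sum_tnth.
have mI : measurable_fun setT (fun x => (+oo * (\1_N0 x : R)%:E)%E).
  by apply: measurable_funeM; apply/measurable_EFinP; exact: measurable_indic.
have mH : measurable_fun setT H by exact: (measurableT_comp mI).
have mHs : measurable_fun setT (fun z : n.-tuple (X * R) => \sum_(i < n) H (tnth z i))%E.
  by apply: emeasurable_sum => i; apply: measurableT_comp => //; exact: measurable_tnth.
have iH : (\int[rho]_z H z = 0)%E.
  rewrite (ge0_integral_marginal hnu mI) => [|x]; last first.
    by rewrite mule_ge0// lee_fin indicE; case: (_ \in _).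
  rewrite ge0_integralZl//.
  - rewrite integral_indic// setIT [X in (_ * X)%E](_ : _ = 0%E) ?mule0//.
  - by apply/measurable_EFinP; exact: measurable_indic.
have Hs0 : (\int[product_power rho n]_z \sum_(i < n) H (tnth z i) = 0)%E.
  rewrite ge0_integral_sum//; last first.
    by move=> i; apply: measurableT_comp => //; exact: measurable_tnth.
  by rewrite big1// => i _; rewrite (integral_product_power_tnth rho i mH).
have bound_sum N : \sum_(0 <= j < N) bound j <=
   (C ^+ 2 * rad ^+ 2 + V * Ce) * (lam `^ (2 * r) + lam `^ (- (1 + 1 / b)) / n%:R).
  pose v j := if 0 < mu_ j then s lam (mu_ j) ^+ 2 * mu_ j else 0.
  have v0 j : 0 <= v j.
    by rewrite /v; case: ifP => // j0; rewrite mulr_ge0 ?sqr_ge0// ltW.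
  have Sv : \sum_(0 <= j < N) v j <= Ce * lam `^ (- (1 + 1 / b)).
    apply: hCe => // j; rewrite /v; case: ifPn => j0.
    - by have [] := hs' lam j lam0 j0.
    - by rewrite divr_ge0// ltW.
    - by have [] := hs' lam j lam0 j0.
    - apply: mulr_ge0; first by apply: divr_ge0; exact: sqr_ge0.
      by apply: divr_ge0; [exact: ltW|exact: powR_ge0].
  have Sw : \sum_(0 <= j < N | 0 < mu_ j) L2dot w (e j) ^+ 2 <= rad ^+ 2.
    apply: le_trans (Bessel e_ortho w N) _.
    by rewrite ler_sqr ?nnegrE ?L2norm_ge0// (le_trans (L2norm_ge0 w)).
  have -> : \sum_(0 <= j < N) bound j = \sum_(0 <= j < N | 0 < mu_ j)
      (s lam (mu_ j) * (mu_ j * f_ j) - f_ j) ^+ 2 + V / n%:R * \sum_(0 <= j < N) v j.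
    rewrite mulr_sumr [X in X + _]big_mkcond -big_split/=; apply: eq_bigr => j _.
    rewrite /bound /v; case: ifP => _; last by rewrite mulr0 addr0.
    by congr (_ + _); ring.
  have Sb : \sum_(0 <= j < N | 0 < mu_ j) (s lam (mu_ j) * (mu_ j * f_ j) - f_ j) ^+ 2
      <= C ^+ 2 * lam `^ (2 * r) * rad ^+ 2.
    apply: (@le_trans _ _ (C ^+ 2 * lam `^ (2 * r) *
        \sum_(0 <= j < N | 0 < mu_ j) L2dot w (e j) ^+ 2)); last first.
      by apply: ler_wpM2l => //; apply: mulr_ge0; [exact: sqr_ge0|exact: powR_ge0].
    rewrite mulr_sumr; apply: ler_sum => j j0; rewrite fE//.
    have [_ _ _ hb] := hs' lam j lam0 j0.
    apply: le_trans (ler_wpM2r (sqr_ge0 _) hb).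
    by rewrite le_eqVlt; apply/orP; left; apply/eqP; ring.
  have SV : V / n%:R * \sum_(0 <= j < N) v j <= V / n%:R * (Ce * lam `^ (- (1 + 1 / b))).
    by apply: ler_wpM2l => //; rewrite divr_ge0.
  apply: le_trans (lerD Sb SV) _; rewrite -subr_ge0.
  set l1 := lam `^ (2 * r); set l2 := lam `^ _.
  have l10 : 0 <= l1 by exact: powR_ge0.
  have l20 : 0 <= l2 by exact: powR_ge0.
  rewrite (_ : _ - _ = C ^+ 2 * rad ^+ 2 * (l2 / n%:R) + V * Ce * l1).
    apply: addr_ge0; apply: mulr_ge0 => //.
    - by apply: mulr_ge0; exact: sqr_ge0.
    - exact: divr_ge0.
    - exact: mulr_ge0.
  by field; rewrite pnatr_eq0 -lt0n.
rewrite /risk unlock.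
apply: (@le_trans _ _ (\int[product_power rho n]_z
    (\sum_(i < n) H (tnth z i) + \sum_(j <oo) term j z))%E).
  apply: ge0_le_integral_nonmeasurable => z; first by rewrite lee_fin sqr_ge0.
  have [[i Hi]|good] := pselect (exists i, N0 (tnth z i).1).
    have rest0 : (0 <= \sum_(k < n | k != i) H (tnth z k))%E by exact: sume_ge0.
    have ser0 : (0 <= \sum_(k <oo) term k z)%E by exact: nneseries_ge0.
    have geN (x : \bar R) : (0 <= x)%E -> (x != -oo)%E.
      by move=> x0; rewrite -ltNye (lt_le_trans _ x0).
    rewrite (bigD1 i)//= {1}/H indicE mem_set// mule1.
    by rewrite !addye ?leey ?geN.
  have sz i : spanned mu_ e (phi (tnth z i).1).
    apply: contrapT => nsp; apply: good; exists i; apply: subN0 => /= H1.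
    exact: nsp.
  have -> : (\sum_(j <oo) term j z =
      (L2norm (estimator phi mu_ e s lam z - fdag) ^+ 2)%:E)%E.
    have hC j : 0 < mu_ j -> `|s lam (mu_ j)| <= E / lam.
      by move=> j0; have [] := hs' lam j lam0 j0.
    rewrite (sqr_dist_spectral_fun e_ortho hC
      (or_intror (spanned_empirical_adjoint sz)) fcvg).
    rewrite [RHS]eseries_mkcond; apply: eq_eseriesr => j _; rewrite /term.
    by rewrite (L2dot_empirical_adjoint (operator_kernel hA)).
  by rewrite leeDr// sume_ge0.
rewrite ge0_integralD//; last 3 first.
- by move=> z _; exact: sume_ge0.
- by move=> z _; exact: nneseries_ge0.
- exact: ge0_emeasurable_sum.
rewrite Hs0 add0e integral_nneseries//.
apply: lime_le; first by apply: is_cvg_nneseries => j _ _; exact: integral_ge0.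
apply: nearW => N; apply: (@le_trans _ _ (\sum_(0 <= j < N) (bound j)%:E)%E).
  apply: lee_sum => j _; rewrite /term /bound; case: ifPn => j0.
    have [iW Wm WV] := hV j j0.
    exact: expectation_sqr_mean_le.
  by rewrite integral0.
by rewrite sumEFin lee_fin.
Qed.

End risk_bound.

(** * The rate of convergence *)

Theorem lemma6 (R : realType)
  (d1 d2 : measure_display) (T : measurableType d1) (X : measurableType d2)
  (mu : {sigma_finite_measure set T -> \bar R}) (nu : probability X R)
  (phi : X -> L2 mu) (A : {linear L2 mu -> L2 nu})
  (hA : kernel_operator phi A)
  (Astar : L2 nu -> L2 mu) (hAstar : is_adjoint A Astar)
  (mu_ : nat -> R) (e : nat -> L2 mu)
  (he : eigensystem (Astar \o A) mu_ e)
  (s : R -> R -> R) (q : R)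
  (hs : regularization (spectrum (Astar \o A)) s q)
  (rho : probability (X * R)%type R)
  (hnu : forall U : set X, measurable U -> rho (U `*` setT) = nu U)
  (Y : set R) (mY : measurable Y) (hY : rho (setT `*` Y) = 1%E)
  (y : L2 nu) (fdag : L2 mu) (hfdag : generalized_solution A y fdag)
  (hyA : A fdag = y %[ae nu])
  (hmean : conditional_expectation rho nu snd y)
  (sigma : R)
  (hvar : conditional_variance rho nu snd (cst (sigma ^+ 2)))
  (r rad : R) (r0 : 0 < r) (rq : r <= q) (rad0 : 0 < rad)
  (hsource : source_set mu_ e r rad fdag)
  (dd b : R) (d0 : 0 < dd) (b1 : 1 < b)
  (hdecay : forall j : nat, mu_ j <= dd / (j.+1%:R `^ b))
  (lam : nat -> R) (lam0 : forall n, 0 < lam n)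
  (hlam : lam =Theta_\oo
    (fun n : nat => n%:R^-1 `^ (1 / (2 * r + 1 + 1 / b)) : R)) :
  (\forall n \near \oo,
     risk rho fdag (estimator phi mu_ e s (lam n) (n := n)) \is a fin_num) /\
  (fun n : nat =>
     fine (risk rho fdag (estimator phi mu_ e s (lam n) (n := n))))
  =O_\oo (fun n : nat => n%:R^-1 `^ (2 * r / (2 * r + 1 + 1 / b)) : R).
Proof.
pose p := 2 * r + 1 + 1 / b.
have b0 : 0 < b by apply: lt_trans b1.
have p0 : 0 < p.
  apply: addr_gt0; last exact: divr_gt0.
  by apply: addr_gt0 => //; exact: mulr_gt0.
have [k1 [k2 [k10 k20 hk]]] : exists k1 k2 : R, [/\ 0 < k1, 0 < k2 & \forall n \near \oo,
    k1 * (n%:R^-1 `^ (1 / p)) <= lam n <= k2 * (n%:R^-1 `^ (1 / p))].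
  move: hlam; rewrite eqThetaE qualifE => /asboolP[[k1 k2] /= /andP[k10 k20] hk].
  exists k1, k2; split=> //; apply: filterS hk => n.
  by rewrite !ger0_norm ?powR_ge0 ?(ltW (lam0 n))// => -[-> ->].
have [K K0 hK] := risk_le hA hAstar he hs hnu hyA hmean hvar r0 rq hsource d0 b1 hdecay k20.
have risk0 n : (0 <= risk rho fdag (estimator phi mu_ e s (lam n) (n := n)))%E.
  by rewrite /risk unlock; apply: integral_ge0 => z _; rewrite lee_fin sqr_ge0.
pose M := K * (k2 `^ (2 * r) + k1 `^ (- (1 + 1 / b))).
have M0 : 0 <= M by apply: mulr_ge0 => //; apply: addr_ge0; exact: powR_ge0.
have main : \forall n \near \oo,
  (risk rho fdag (estimator phi mu_ e s (lam n) (n := n)) <=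
   (M * n%:R^-1 `^ (2 * r / p))%:E)%E.
  have n1 : \forall n \near \oo, (0 < n)%N by exists 1%N.
  apply: filterS2 n1 hk => n n0 /andP[l1 l2].
  set x : R := n%:R^-1 in l1 l2 *.
  have x0 : 0 < x by rewrite invr_gt0 ltr0n.
  have x1 : x <= 1 by rewrite invf_le1 ?ltr0n// ler1n.
  have g0 : 0 < x `^ (1 / p) by exact: powR_gt0.
  have g1 : x `^ (1 / p) <= 1.
    rewrite [leRHS](_ : 1 = 1 `^ (1 / p)); last by rewrite powR1.
    by rewrite ge0_ler_powR ?nnegrE ?divr_ge0 ?(ltW p0) ?(ltW x0).
  have lk2 : lam n <= k2 by apply: le_trans l2 _; rewrite ler_piMr// ltW.
  apply: le_trans (hK n (lam n) n0 (lam0 n) lk2) _.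
  rewrite lee_fin /M -mulrA; apply: ler_wpM2l => //. rewrite [leRHS]mulrDl; apply: lerD.
    apply: (@le_trans _ _ ((k2 * x `^ (1 / p)) `^ (2 * r))).
      rewrite ge0_ler_powR ?nnegrE ?mulr_ge0 ?powR_ge0 ?(ltW r0) ?(ltW k20) ?(ltW (lam0 n))//.
    rewrite powRM ?(ltW k20) ?(ltW g0)// -powRrM.
    by rewrite (_ : 1 / p * (2 * r) = 2 * r / p)//; field; rewrite gt_eqF.
  apply: (@le_trans _ _ ((k1 * x `^ (1 / p)) `^ (- (1 + 1 / b)) * x)).
    apply: ler_wpM2r; first exact: ltW.
    rewrite !powRN lef_pV2 ?posrE ?powR_gt0 ?mulr_gt0//.
    have c0 : 0 <= 1 + 1 / b by apply: addr_ge0 => //; apply: divr_ge0 => //; exact: ltW.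
    by rewrite ge0_ler_powR ?nnegrE ?mulr_ge0 ?(ltW k10) ?(ltW g0) ?(ltW (lam0 n)).
  rewrite powRM ?(ltW k10) ?(ltW g0)// -powRrM -mulrA; apply: ler_wpM2l; first exact: powR_ge0.
  rewrite -{2}(powRr1 (ltW x0)) -powR_gt0D//.
  rewrite (_ : 1 / p * - (1 + 1 / b) + 1 = 2 * r / p)//.
  have -> : 2 * r = p - (1 + 1 / b) by rewrite /p; ring.
  by field; rewrite !gt_eqF.
split.
  apply: filterS main => n; rewrite ge0_fin_numE// => /le_lt_trans; apply; exact: ltry.
apply/eqO_exP; exists (M + 1); first exact: ltr_wpDl.
apply: filterS main => n rn; rewrite ger0_norm ?fine_ge0// (ger0_norm (powR_ge0 _ _)).
apply: (@le_trans _ _ (M * n%:R^-1 `^ (2 * r / p))).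
  rewrite -lee_fin fineK// ge0_fin_numE//; apply: le_lt_trans rn _; exact: ltry.
by apply: ler_wpM2r; [exact: powR_ge0|rewrite lerDl].
Qed.
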